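(* The finitely generated abelian groups that occur (up to isomorphism) as groups of units of integral domains are exactly the following: (i) for integral domains of characteristic zero: the groups of the form $C_{2n}\times\mathbb{Z}^g$, with $n\ge 1$ an integer and $g\ge 0$ an integer satisfying $g\ge\frac{\phi(2n)}{2}-1$; (ii) for integral domains of finite (i.e. positive) characteristic: the groups of the form $\mathbb{F}_{p^n}^*\times\mathbb{Z}^g$, with $p$ a prime, $n\ge 1$ and $g\ge 0$ integers. That is, a finitely generated abelian group is isomorphic to $A^*$ for some integral domain $A$ of characteristic zero (respectively, of positive characteristic) if and only if it is isomorphic to a group in list (i) (respectively, in list (ii)).
   Context: $A^*$ denotes the group of units of a ring $A$ with $1$; $C_m$ is the cyclic group of order $m$; $\phi$ is Euler's totient function; $\mathbb{F}_q$ is the field with $q$ elements. *)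

(* Defs.v *)
From HB Require Import structures.
From mathcomp Require Import all_boot all_order all_fingroup all_algebra.

Set Implicit Arguments.
Unset Strict Implicit.
Unset Printing Implicit Defensive.

Import GRing.Theory.
Local Open Scope ring_scope.

(* The library's {unit R} only covers finite rings. *)
Record units (R : unitRingType) : Type :=
  MkUnits { units_val : R; units_valP : units_val \is a GRing.unit }.

Section UnitGroup.
Variable R : unitRingType.
Implicit Types u v w : units R.

HB.instance Definition _ := [isSub for @units_val R].
HB.instance Definition _ := [Choice of units R by <:].

Definition units_one : units R := MkUnits (unitr1 R).

Fact units_inv_subproof u : (val u)^-1 \is a GRing.unit.
Proof. by rewrite unitrV (valP u). Qed.
Definition units_inv u : units R := MkUnits (units_inv_subproof u).

Fact units_mul_subproof u v : val u * val v \is a GRing.unit.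
Proof. by rewrite (unitrMr _ (valP u)) (valP v). Qed.
Definition units_mul u v : units R := MkUnits (units_mul_subproof u v).

Fact units_mulA : associative units_mul.
Proof. by move=> u v w; apply/val_inj/mulrA. Qed.
Fact units_mul1 : left_id units_one units_mul.
Proof. by move=> u; apply/val_inj/mul1r. Qed.
Fact units_mulr1 : right_id units_one units_mul.
Proof. by move=> u; apply/val_inj/mulr1. Qed.
Fact units_mulV : left_inverse units_one units_inv units_mul.
Proof. by move=> u; apply/val_inj/(mulVr (valP u)). Qed.
Fact units_mulrV : right_inverse units_one units_inv units_mul.
Proof. by move=> u; apply/val_inj/(mulrV (valP u)). Qed.

HB.instance Definition _ := isGroup.Build (units R)
  units_mulA units_mul1 units_mulr1 units_mulV units_mulrV.

End UnitGroup.

Definition isomorphic (G H : groupType) : Prop :=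
  exists2 f : G -> H, {morph f : x y / (x * y)%g} & bijective f.

Definition abelian_group (G : groupType) : Prop :=
  forall x y : G, (x * y = y * x)%g.

Definition is_subgroup (G : groupType) (H : G -> Prop) : Prop :=
  [/\ H 1%g,
      forall x y : G, H x -> H y -> H (x * y)%g
    & forall x : G, H x -> H x^-1%g].

Definition finitely_generated (G : groupType) : Prop :=
  exists s : seq G, forall H : G -> Prop,
    is_subgroup H -> (forall x, x \in s -> H x) -> forall x, H x.

Definition char_zero (A : idomainType) : Prop := [pchar A] =i pred0.

Definition char_positive (A : idomainType) : Prop :=
  exists p : nat, p \in [pchar A].

Definition free_abelian (g : nat) : groupType :=
  Algebra.to_multiplicative 'rV[int]_g.

(* The additive group of integers modulo m; only meaningful for m >= 2, since
   the library identifies 'Z_0 and 'Z_1 with 'Z_2. *)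
Definition cyclic_group (m : nat) : groupType :=
  Algebra.to_multiplicative 'Z_m.

(* Main.v *)
(* Positive characteristic: if A^* is finitely generated, its torsion is the
   finite group of roots of unity, cyclic of some order N; together with 0 they
   are exactly the solutions of x^q = x for q = p^phi(N), hence form a finite
   field F, and A^* = F^* x Z^g.  Conversely Laurent polynomials over F realize
   F^* x Z^g.

   Characteristic zero: the torsion of A^* is cyclic, of even order m because it
   contains -1, and A contains a copy of Z[zeta_m], hence phi(m)/2 - 1
   independent units.  Conversely Z[zeta_m]^* is C_m x Z^r with
   r <= phi(m)/2 - 1, and Laurent variables raise the rank at will.

   Both facts on Z[zeta_m] come, without logarithms, from one real unit u (found
   by the pigeonhole principle) which is smaller than 1 in absolute value at
   every embedding but the identity and complex conjugation.  The conjugates of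
   u are multiplicatively independent up to the obvious relations: in a relation
   evaluated at the embedding with the largest exponent, raising all exponents
   to the largest one gives the norm of u, which is 1.  They generate a subgroup
   of finite index: if the absolute values of the conjugates of a unit w are
   too spread out, there is a wide gap between them, and dividing w by the
   product of the conjugates of u indexed by the embeddings above the gap lowers
   the trace of |w|^2, a natural number. *)

Require Import Defs.
From HB Require Import structures.
From mathcomp Require Import all_boot all_order all_fingroup all_algebra.
From mathcomp Require Import all_solvable all_field.
From mathcomp Require Import boolp ring lra.

Set Implicit Arguments.
Unset Strict Implicit.
Unset Printing Implicit Defensive.

Import Order.TTheory GRing.Theory Num.Theory.
Local Open Scope ring_scope.

(** * Bounds for finite families and products in ordered fields *)

Section FiniteBounds.
Variables (R : realFieldType) (T : finType) (P : pred T) (f : T -> R).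

Lemma finite_lt1_bound : (forall x, P x -> f x < 1) ->
  exists q, [/\ 0 < q, q < 1 & forall x, P x -> f x <= q].
Proof.
move=> f1.
have [/existsP[x0 Px0]|/existsPn N] := boolP [exists x, P x].
  case: (arg_maxP f Px0) => x Px mx.
  (* The maximum with [1 / 2] keeps the bound positive when all values are not. *)
  exists (Num.max (f x) (1 / 2)); split.
  - by rewrite lt_max; apply/orP; right; lra.
  - by rewrite gt_max f1 //=; lra.
  - by move=> y Py; rewrite le_max; apply/orP; left; apply: mx.
by exists (1 / 2); split; [lra|lra|move=> x Px; move: (N x); rewrite Px].
Qed.

Lemma finite_bound : exists2 c, 1 <= c & forall x, P x -> f x <= c.
Proof.
have [/existsP[x0 Px0]|/existsPn N] := boolP [exists x, P x].
  case: (arg_maxP f Px0) => x Px mx.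
  by exists (Num.max (f x) 1) => [|y Py]; rewrite le_max ?lexx ?orbT //; apply/orP; left; apply: mx.
by exists 1 => // x Px; move: (N x); rewrite Px.
Qed.

End FiniteBounds.

Lemma prodr_gt0_le1_lt1 (R : realFieldType) (I : finType) (P : pred I) (F : I -> R) i0 :
  P i0 -> (forall i, P i -> 0 < F i < 1) -> \prod_(i | P i) F i < 1.
Proof.
move=> Pi0 F01; rewrite (bigD1 i0) //=.
have /andP[F0 F1] := F01 _ Pi0.
apply: le_lt_trans F1; rewrite ler_piMr ?(ltW F0) //.
by apply: prodr_ile1 => i /andP[/F01/andP[/ltW-> /ltW->]].
Qed.

Lemma prod_exprz (R : fieldType) (I : finType) (P : pred I) (F : I -> R) (z : int) :
  \prod_(i | P i) F i ^ z = (\prod_(i | P i) F i) ^ z.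
Proof.
case: z => n; first exact: prodrXl.
under eq_bigr => i _ do rewrite NegzE -exprnN.
by rewrite NegzE -exprnN -prodrXl prodfV.
Qed.

Lemma exprz_npos_gt1 (R : realFieldType) (x : R) (z : int) :
  0 < x < 1 -> z < 0 -> 1 < x ^ z.
Proof.
case: z => // n /andP[x0 x1] _; rewrite NegzE -exprnN.
by rewrite invf_gt1 ?exprn_gt0 // exprn_ilt1 ?ltW.
Qed.

(** * The absolute values of the conjugates of a unit *)

(* [G] plays the role of the Galois group, [c0] of complex conjugation and [l g]
   of the squared absolute value at [g] of a unit [u]; then [l (k * g^-1)] is
   the one at [k] of the conjugate of [u] by [g^-1]. *)
Section LogLattice.
Variables (R : realFieldType) (G : finGroupType) (c0 : G) (l : G -> R).
Hypothesis c02 : (c0 * c0 = 1)%g.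
Hypothesis l_gt0 : forall g, 0 < l g.
Hypothesis l_lt1 : forall g, g != 1%g -> g != c0 -> l g < 1.
Hypothesis l_prod : \prod_g l g = 1.

Lemma prod_shift k : \prod_g l (k * g^-1)%g = 1.
Proof.
rewrite -[RHS]l_prod [RHS](reindex_inj invg_inj).
by rewrite [RHS](reindex_inj (mulIg k^-1%g)) /=; apply: eq_bigr => g _; rewrite invMg invgK.
Qed.

Lemma shift_lt1 k g : g != k -> g != (c0 * k)%g -> l (k * g^-1)%g < 1.
Proof.
move=> gk gck; apply: l_lt1.
  by apply: contra gk; rewrite -eq_mulgV1 eq_sym.
apply: contra gck => /eqP E; apply/eqP.
by rewrite -[k](mulgKV g) E mulgA c02 mul1g.
Qed.

(** Let [k] maximize [b]. Dividing the relation at [k] by the [b k]-th power of [prod_shift] leaves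
    exponents [b g - b k <= 0]. The factors at [k] and [c0 * k], whose bases may exceed 1, get
    exponent 0; the others are at least 1, so a product equal to 1 forces every exponent to
    vanish. *)
Lemma multiplicative_indep (b : G -> int) : (forall g, b (c0 * g)%g = b g) ->
  (forall k, \prod_g l (k * g^-1)%g ^ b g = 1) -> forall g h, b g = b h.
Proof.
move=> b_even bP.
have [k mk] : exists k, forall g, b g <= b k.
  case: (arg_maxP b (isT : xpredT (1%g : G))) => k _ mk.
  by exists k => g; apply: mk.
suff E g : b g = b k by move=> g h; rewrite !E.
have : \prod_g l (k * g^-1)%g ^ (b g - b k) = 1.
  under eq_bigr => g0 _ do rewrite expfzDr ?gt_eqF //.
  by rewrite big_split /= bP mul1r prod_exprz prod_shift exp1rz.
have [->//|gk] := eqVneq g k; have [->|gck] := eqVneq g (c0 * k)%g.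
  by rewrite b_even.
move=> P1; apply/eqP; move: P1; apply: contra_eqT => bgk.
rewrite gt_eqF // (bigD1 g) //=.
have xb g0 : 1 <= l (k * g0^-1)%g ^ (b g0 - b k).
  have [->|gk0] := eqVneq g0 k; first by rewrite subrr expr0z.
  have [->|gck0] := eqVneq g0 (c0 * k)%g; first by rewrite b_even subrr expr0z.
  have := mk g0; rewrite le_eqVlt => /orP[/eqP->|bl]; first by rewrite subrr expr0z.
  by rewrite ltW // exprz_npos_gt1 ?l_gt0 ?shift_lt1 // subr_lt0.
suff x1 : 1 < l (k * g^-1)%g ^ (b g - b k).
  apply: lt_le_trans x1 _; rewrite ler_peMr ?(ltW (exprz_gt0 _ _)) //.
  by elim/big_ind: _ => // x y x1 y1; rewrite -[1]mulr1 ler_pM.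
by rewrite exprz_npos_gt1 ?l_gt0 ?shift_lt1 // subr_lt0 lt_neqAle bgk mk.
Qed.

Lemma even_subset_c0 (S : {set G}) : (forall g, g \in S -> (c0 * g)%g \in S) ->
  forall g, ((c0 * g)%g \in S) = (g \in S).
Proof.
move=> Se g; apply/idP/idP; last exact: Se.
by move=> /Se; rewrite mulgA c02 mul1g.
Qed.

(* The effect at [k] of dividing by the conjugates of [u] indexed by [S]. *)
Definition contraction (S : {set G}) k := \prod_(g in S) (l (k * g^-1)%g)^-1.

Lemma contraction_gt0 S k : 0 < contraction S k.
Proof. by apply: prodr_gt0 => g _; rewrite invr_gt0. Qed.

(* As the full product is 1, the product over [S] is the inverse of the product
   over the complement of [S], all of whose factors are smaller than 1. *)
Lemma contraction_lt1 (S : {set G}) k j : (forall g, g \in S -> (c0 * g)%g \in S) ->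
  k \in S -> j \notin S -> contraction S k < 1.
Proof.
move=> /even_subset_c0 Se kS jS.
have E : contraction S k = \prod_(g | g \notin S) l (k * g^-1)%g.
  have := prod_shift k; rewrite (bigID (mem S)) /= /contraction => E.
  by rewrite prodfV; apply: mulr1_eq.
rewrite E; apply: (@prodr_gt0_le1_lt1 _ _ _ _ j) => // g gS; rewrite l_gt0 shift_lt1 //.
  by apply: contraNneq gS => ->.
by apply: contraNneq gS => ->; rewrite Se.
Qed.

(* The [#|G|.+1] intervals [K^i.+1, K^i.+2) cannot all contain one of the
   [#|G|] values of [y]. *)
Lemma gap (K : R) (y : G -> R) : 1 < K -> \prod_g y g = 1 -> (forall g, 0 < y g) ->
  (exists g, K ^+ #|G|.+2 <= y g) ->
  exists a, [/\ 0 < a, exists g, K * a <= y g, exists g, y g < a &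
               forall g, y g < a \/ K * a <= y g].
Proof.
move=> K1 y1 y0 [g0 gy0].
have K0 : 0 < K by lra.
have [i Pi] : exists i : 'I_#|G|.+1, forall g, (y g < K ^+ i.+1) || (K * K ^+ i.+1 <= y g).
  suff /existsP[i /forallP] : [exists i : 'I_#|G|.+1,
     forall g, (y g < K ^+ i.+1) || (K * K ^+ i.+1 <= y g)] by exists i.
  rewrite -[X in is_true X]negbK negb_exists; apply/negP => /forallP N.
  have {}N (i : 'I_#|G|.+1) : {g | K ^+ i.+1 <= y g < K ^+ i.+2}.
    apply: sigW; have := N i; rewrite negb_forall => /existsP[g].
    by rewrite negb_or -leNgt -ltNge -exprS => /andP[? ?]; exists g; apply/andP.
  have /leq_card : injective (fun i => sval (N i)).
    move=> i j; case: (N i) => g /= /andP[gi1 gi2]; case: (N j) => _ /= /[swap]<- /andP[gj1 gj2].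
    have := le_lt_trans gi1 gj2; have := le_lt_trans gj1 gi2.
    rewrite !ltr_eXn2l // !ltnS => ji ij; apply/val_inj/eqP.
    by rewrite /= eqn_leq ij ji.
  by rewrite card_ord ltnn.
have Ki1 : 1 < K ^+ i.+1 by rewrite exprn_egt1.
exists (K ^+ i.+1); split.
- by rewrite exprn_gt0.
- exists g0; rewrite -exprS; apply: le_trans gy0; rewrite ler_eXn2l //.
  by rewrite ltnS; apply: ltn_ord.
(* Some value is at most 1, hence below every power of [K], because the product is 1. *)
- suff /existsP[g yg] : [exists g, y g <= 1] by exists g; lra.
  rewrite -[X in is_true X]negbK negb_exists; apply/negP => /forallP N.
  suff : 1 < \prod_g y g by rewrite y1 ltxx.
  rewrite (bigD1 1%g) //=; have N1 := N 1%g; rewrite -ltNge in N1.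
  rewrite (lt_le_trans N1) // ler_peMr ?(ltW (y0 _)) //.
  elim/big_ind: _ => // [x z x1 z1|g _]; first by rewrite -[1]mulr1 ler_pM.
  by rewrite ltW // ltNge.
by move=> g; apply/orP.
Qed.

(** There are finitely many pairs [(S, k)], so one [q < 1] bounds all contractions inside proper
    even sets, and one [c] bounds all contractions. With [S] the part above a gap, the terms in [S]
    lose at least [(1 - q) * K * a] in total, while the others become at most [#|G| * c * a]. *)
Lemma contraction_decrease : exists B, forall y : G -> R, \prod_g y g = 1 ->
  (forall g, 0 < y g) -> (forall g, y (c0 * g)%g = y g) -> (exists g, B <= y g) ->
  exists S, \sum_g y g * contraction S g < \sum_g y g.
Proof.
pose P (x : {set G} * G) :=
  [&& [forall g in x.1, (c0 * g)%g \in x.1], x.2 \in x.1 & x.1 != [set: G]].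
have [x /and3P[/forall_inP Se xS SN]|q [q0 q1 qP]] :=
    @finite_lt1_bound _ _ P (fun x => contraction x.1 x.2).
  have [j _ jS] : exists2 j, j \in [set: G] & j \notin x.1.
    by apply/subsetPn; move: SN; rewrite eqEsubset subsetT.
  exact: (contraction_lt1 Se xS jS).
have [c c1 cP] := @finite_bound _ _ xpredT (fun x : {set G} * G => contraction x.1 x.2).
have n0 : (0 : R) < #|G|%:R by rewrite ltr0n; apply/card_gt0P; exists 1%g.
(* Chosen so that [(1 - q) * K] exceeds [#|G| * c]: the loss above the gap outweighs what remains
   below it. *)
pose K := #|G|%:R * c / (1 - q) + 1.
have K1 : 1 < K.
  by rewrite ltrDr divr_gt0 ?subr_gt0 // mulr_gt0 // (lt_le_trans _ c1).
exists (K ^+ #|G|.+2) => y y1 y0 ye yB.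
have [a [a0 [g1 Kg1] [g2 ag2] aP]] := gap K1 y1 y0 yB.
have aKa : a < K * a by rewrite ltr_pMl.
pose S := [set g | K * a <= y g]; exists S.
have Se g : g \in S -> (c0 * g)%g \in S by rewrite !inE ye.
have SN : S != [set: G].
  apply/negP => /eqP/setP/(_ g2); rewrite !inE => aP2; have := lt_trans ag2 aKa.
  by rewrite ltNge aP2.
have PS g : g \in S -> P (S, g).
  by move=> gS; apply/and3P; split => //; apply/forall_inP.
rewrite (bigID (mem S)) [ltRHS](bigID (mem S)) /=.
have {}qP : \sum_(g in S) y g * contraction S g <= q * \sum_(g in S) y g.
  rewrite mulr_sumr ler_sum // => g gS; rewrite mulrC ler_pM2r //.
  exact: (qP _ (PS _ gS)).
have {}cP : \sum_(g | g \notin S) y g * contraction S g <= #|G|%:R * c * a.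
  apply: (@le_trans _ _ (\sum_(g | g \notin S) c * a)).
    apply: ler_sum => g; rewrite inE -ltNge => gS.
    have {}gS : y g < a by case: (aP g) => //; lra.
    rewrite mulrC ler_pM ?(ltW (contraction_gt0 _ _)) ?(ltW (y0 _)) ?(ltW gS) //.
    exact: (cP (S, g)).
  rewrite sumr_const -[leLHS]mulr_natl -mulrA ler_wpM2r ?ler_nat ?max_card //.
  by rewrite mulr_ge0 // ltW // (lt_le_trans _ c1).
have g1S : K * a <= \sum_(g in S) y g.
  rewrite (bigD1 g1) ?inE //= ler_wpDr // sumr_ge0 // => g _; exact: ltW.
have g2S : 0 <= \sum_(g | g \notin S) y g by apply: sumr_ge0 => g _; apply: ltW.
have KE : (1 - q) * (K * a) = (#|G|%:R * c + (1 - q)) * a.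
  rewrite /K; field; lra.
have : (1 - q) * (K * a) <= (1 - q) * \sum_(g in S) y g by rewrite ler_pM2l ?subr_gt0.
have : 0 < (1 - q) * a by rewrite mulr_gt0 ?subr_gt0.
rewrite KE; lra.
Qed.

End LogLattice.

(** * Finitely generated abelian groups *)

Lemma rat_row_scale n (u : 'rV[rat]_n) : u != 0 ->
  exists2 a : 'rV[int]_n, a != 0 & exists2 c : rat, c != 0 & map_mx intr a = c *: u.
Proof.
move=> u0; pose N := \prod_i denq (u 0 i).
have N0 : N != 0 by apply/prodf_neq0 => i _; rewrite denq_neq0.
have Nu i : {z : int | z%:~R = N%:~R * u 0 i}.
  exists ((\prod_(j | j != i) denq (u 0 j)) * numq (u 0 i)).
  by rewrite /N [in RHS](bigD1 i) //= !intrM numqE; ring.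
have E : map_mx intr (\row_i sval (Nu i)) = N%:~R *: u.
  by apply/rowP => i; rewrite !mxE; case: (Nu i).
exists (\row_i sval (Nu i)); last by exists N%:~R; rewrite ?intr_eq0.
apply: contra u0 => /eqP a0; move: E; rewrite a0 map_mx0 => /esym/eqP.
by rewrite scaler_eq0 intr_eq0 (negPf N0).
Qed.

(** With more rows than columns there is a rational left kernel vector, whose denominators are then
    cleared. *)
Lemma int_row_kernel r g (W : 'M[int]_(r, g)) : (g < r)%N ->
  exists2 a : 'rV[int]_r, a != 0 & a *m W = 0.
Proof.
move=> gr; have : kermx (map_mx (intr : int -> rat) W) != 0.
  rewrite -mxrank_eq0 mxrank_ker subn_eq0 -ltnNge.
  by apply: leq_ltn_trans gr; apply: rank_leq_col.
case/rowV0Pn => u uK u0; have [a a0 [c c0 ac]] := rat_row_scale u0.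
exists a => //; apply/matrixP => i j; apply: (intr_inj : injective (intr : int -> rat)).
have : map_mx (intr : int -> rat) (a *m W) = 0.
  by rewrite map_mxM ac -scalemxAl (sub_kermxP uK) scaler0.
by move=> /matrixP/(_ i j); rewrite !mxE.
Qed.

Section LinearCombination.
Variable V : zmodType.

Definition lincomb n (x : 'I_n -> V) (v : 'rV[int]_n) := \sum_i x i *~ v 0 i.

Lemma lincomb_mulmx m n (x : 'I_n -> V) (v : 'rV[int]_m) (A : 'M_(m, n)) :
  lincomb x (v *m A) = lincomb (fun i => lincomb x (row i A)) v.
Proof.
rewrite /lincomb; under eq_bigr => i _ do rewrite mxE mulrz_sumr.
rewrite exchange_big /=; apply: eq_bigr => i _.
by rewrite mulrz_suml; apply: eq_bigr => j _; rewrite mxE mulrC mulrzA.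
Qed.

Lemma lincombD n (x : 'I_n -> V) v w : lincomb x (v + w) = lincomb x v + lincomb x w.
Proof. by rewrite -big_split; apply: eq_bigr => i _; rewrite mxE mulrzDr. Qed.

Lemma lincombN n (x : 'I_n -> V) v : lincomb x (- v) = - lincomb x v.
Proof. by rewrite -sumrN; apply: eq_bigr => i _; rewrite mxE mulrNz. Qed.

Lemma lincombB n (x : 'I_n -> V) v w : lincomb x (v - w) = lincomb x v - lincomb x w.
Proof. by rewrite lincombD lincombN. Qed.

Lemma lincomb0 n (x : 'I_n -> V) : lincomb x 0 = 0.
Proof. by rewrite /lincomb big1 // => i _; rewrite mxE mulr0z. Qed.

Lemma lincombMn n (x : 'I_n -> V) v k : lincomb x (v *+ k) = lincomb x v *+ k.
Proof. by elim: k => [|k IH]; rewrite ?lincomb0 // !mulrS lincombD IH. Qed.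

Lemma lincomb_delta n (x : 'I_n -> V) i : lincomb x (delta_mx 0 i) = x i.
Proof.
rewrite /lincomb (bigD1 i) //= mxE !eqxx big1 ?addr0 // => j ji.
by rewrite mxE (negPf ji) andbF.
Qed.

Definition torsion (t : V) := exists2 k, (0 < k)%N & t *+ k = 0.

Lemma torsion0 : torsion 0.
Proof. by exists 1. Qed.

Lemma torsionD s t : torsion s -> torsion t -> torsion (s + t).
Proof.
move=> [k k0 sk] [l l0 tl]; exists (k * l)%N; first by rewrite muln_gt0 k0.
by rewrite mulrnDl mulrnA sk mul0rn mulnC mulrnA tl mul0rn addr0.
Qed.

Lemma torsionN t : torsion t -> torsion (- t).
Proof. by move=> [k k0 tk]; exists k; rewrite // mulNrn tk oppr0. Qed.

Definition free_mod_torsion n (x : 'I_n -> V) := forall v, torsion (lincomb x v) -> v = 0.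

(* Induction on the number of generators: if they are dependent modulo torsion,
   the Smith form of a relation yields new generators, the first one torsion. *)
Lemma span_torsion_free n (x : 'I_n -> V) : exists g (y : 'I_g -> V) (ts : seq V),
  [/\ forall v, exists2 t, t \in ts & exists b, lincomb x v = t + lincomb y b,
      forall t, t \in ts -> torsion t
    & free_mod_torsion y].
Proof.
elim: n x => [|n IHn] x.
  exists 0, x, [:: 0]; split.
  - by move=> v; exists 0; rewrite ?inE //; exists v; rewrite add0r.
  - by move=> t; rewrite inE => /eqP->; apply: torsion0.
  - by move=> v _; apply/rowP => -[].
have [free_x|] := pselect (free_mod_torsion x).
  exists n.+1, x, [:: 0]; split => //.
  - by move=> v; exists 0; rewrite ?inE //; exists v; rewrite add0r.
  - by move=> t; rewrite inE => /eqP->; apply: torsion0.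
move=> /existsNP[v /not_implyP[[k k0 vk] /eqP v0]].
pose a := v *+ k.
have a0 : a != 0.
  apply: contra v0 => /eqP/rowP a0; apply/eqP/rowP => i; move: (a0 i).
  by rewrite /a mulmxnE !mxE => /eqP; rewrite mulrn_eq0 eqn0Ngt k0 => /eqP.
have xa : lincomb x a = 0 by rewrite lincombMn.
(* The Smith form of a single row has at most one nonzero entry, the first. For the new generators
   [x'] given by the rows of [R], the relation therefore reads [x' 0 *~ e = 0]. *)
have [L _ [R R_unit [d _ aE]]] := int_Smith_normal_form a.
pose x' i := lincomb x (row i R).
have x'E v' : lincomb x v' = lincomb x' (v' *m invmx R).
  by rewrite -lincomb_mulmx -mulmxA mulVmx // mulmx1.
pose e := L 0 0 * d`_0.
have LD j : (L *m \matrix_(i < 1, j < n.+1) (d`_i *+ (i == j :> nat))) 0 j = e *+ (j == 0).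
  rewrite mxE big_ord1 mxE /e -mulrnAr; congr (_ * (_ *+ _)).
  by rewrite eq_sym.
have e0 : e != 0.
  apply: contra a0 => /eqP e0; rewrite aE; apply/eqP; rewrite (_ : L *m _ = 0) ?mul0mx //.
  by apply/rowP => j; rewrite LD e0 mul0rn mxE.
have x'0 : x' 0 *~ e = 0.
  rewrite -[LHS]addr0 -{}[RHS]xa aE lincomb_mulmx [RHS]big_ord_recl LD eqxx; congr (_ + _).
  by rewrite big1 // => i _; rewrite LD mulr0z.
have [g [y [ts [yP tsP y_free]]]] := IHn (fun i => x' (lift 0 i)).
(* The coordinate along [x' 0] matters only modulo [e], so the list of torsion elements is enlarged
   by [|e|] translates. *)
exists g, y, [seq t + x' 0 *+ i | t <- ts, i <- iota 0 `|e|]; split => //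
  [w|_ /allpairsP[[t i] [/= /tsP tT _ ->]]].
  pose w' := w *m invmx R; pose z := w' 0 0.
  have [t tts [b tb]] := yP (\row_i w' 0 (lift 0 i)).
  exists (t + x' 0 *+ `|(modz z e)|).
    apply/allpairsP; exists (t, `|(modz z e)|%N); split => //=.
    by rewrite mem_iota /= -ltz_nat gez0_abs ?modz_ge0 // ltz_mod.
  exists b; rewrite x'E -/w' [LHS]big_ord_recl.
  have -> : \sum_(i < n) x' (lift 0 i) *~ w' 0 (lift 0 i) = t + lincomb y b.
    by rewrite -tb; apply: eq_bigr => i _; rewrite [in RHS]mxE.
  rewrite addrA [_ + t]addrC; congr (_ + _ + _).
  rewrite -/z {1}(divz_eq z e) mulrzDr mulrC mulrzA x'0 mul0rz add0r.
  by rewrite pmulrn gez0_abs ?modz_ge0.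
apply: torsionD => //; exists `|e|%N; first by rewrite absz_gt0.
rewrite -mulrnA mulnC mulrnA (_ : x' 0 *+ `|e| = 0) ?mul0rn //.
by case: (e) x'0 => m //; rewrite NegzE mulrNz => /eqP; rewrite oppr_eq0 => /eqP.
Qed.

End LinearCombination.

(** An alias of [G] for additive notation; the proof of commutativity is a parameter of the type so
    that the [zmodType] instance can use it. *)
Definition zmod_of (G : groupType) of abelian_group G : Type := G.

Section AbelianGroup.
Variables (G : groupType) (abG : abelian_group G).

HB.instance Definition _ := Choice.copy (zmod_of abG) G.
HB.instance Definition _ := GRing.isZmodule.Build (zmod_of abG)
  (@mulgA G) abG (@mul1g G) (@mulVg G).

Lemma finitely_generated_lincomb : finitely_generated G ->
  exists n (x : 'I_n -> zmod_of abG), forall v, exists a, v = lincomb x a.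
Proof.
case=> s sP; pose x (i : 'I_(size s)) : zmod_of abG := nth 1%g s i.
exists (size s), x; apply: (sP (fun v => exists a, v = lincomb x a)).
  split.
  - by exists 0; rewrite lincomb0.
  - by move=> _ _ [a ->] [b ->]; exists (a + b); rewrite lincombD.
  - by move=> _ [a ->]; exists (- a); rewrite lincombN.
move=> v vs; have lt_i : (index v s < size s)%N by rewrite index_mem.
exists (delta_mx 0 (Ordinal lt_i)); rewrite lincomb_delta /x /= nth_index //.
Qed.

End AbelianGroup.

(** * Subrings of fields and Laurent polynomials *)

Definition subdomain (K : fieldType) (S : subringClosed K) : Type := {x : K | x \in S}.

Section Subdomain.
Variables (K : fieldType) (S : subringClosed K).

HB.instance Definition _ := [isSub of subdomain S for @sval K _].
HB.instance Definition _ := [Choice of subdomain S by <:].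
HB.instance Definition _ := [SubChoice_isSubComNzRing of subdomain S by <:].

Definition subdomain_unit : {pred subdomain S} :=
  fun x => (val x != 0) && ((val x)^-1 \in S).

Definition subdomain_inv (x : subdomain S) : subdomain S :=
  if x \in subdomain_unit then insubd x (val x)^-1 else x.

Lemma subdomain_invE x : x \in subdomain_unit -> val (subdomain_inv x) = (val x)^-1.
Proof. by move=> xU; rewrite /subdomain_inv xU insubdK //; case/andP: xU. Qed.

Fact subdomain_mulVx : {in subdomain_unit, left_inverse 1 subdomain_inv *%R}.
Proof.
move=> x xU; apply: val_inj; rewrite rmorphM rmorph1 /= subdomain_invE //.
by rewrite mulVf //; case/andP: xU.
Qed.

Fact subdomain_unitPl x y : y * x = 1 -> x \in subdomain_unit.
Proof.
move=> /(congr1 val); rewrite rmorphM rmorph1 /= => yx1.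
have x0 : val x != 0.
  by apply: contra_eq_neq yx1 => ->; rewrite mulr0 eq_sym oner_neq0.
by apply/andP; split => //; rewrite (mulr1_eq (etrans (mulrC _ _) yx1)) (valP y).
Qed.

Fact subdomain_inv_out : {in [predC subdomain_unit], subdomain_inv =1 id}.
Proof. by move=> x; rewrite inE /subdomain_inv /= => /negPf->. Qed.

HB.instance Definition _ := GRing.ComNzRing_hasMulInverse.Build (subdomain S)
  subdomain_mulVx subdomain_unitPl subdomain_inv_out.

Fact subdomain_integral (x y : subdomain S) : x * y = 0 -> (x == 0) || (y == 0).
Proof.
move=> /(congr1 val); rewrite rmorphM rmorph0 => /eqP.
by rewrite mulf_eq0 -!(inj_eq val_inj).
Qed.

HB.instance Definition _ := GRing.ComUnitRing_isIntegral.Build (subdomain S)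
  subdomain_integral.

Lemma subdomain_pchar : [pchar (subdomain S)] =i [pchar K].
Proof.
move=> p; rewrite !inE; congr (_ && _).
by rewrite -(inj_eq val_inj) rmorph_nat rmorph0.
Qed.

End Subdomain.

(** * Unit groups described inside an ambient field *)

Lemma bijective_of_inj_surj (T U : choiceType) (f : T -> U) :
  injective f -> (forall y, exists x, f x = y) -> bijective f.
Proof.
move=> f_inj f_surj.
have {}f_surj y : {x | f x = y}.
  have /sigW[x /eqP fx] : exists x, f x == y by have [x <-] := f_surj y; exists x.
  by exists x.
exists (fun y => sval (f_surj y)) => [x|y]; last by case: (f_surj y).
by apply: f_inj; case: (f_surj _).
Qed.

(** Describes the unit group of [S] by elements of the ambient field. In this form the description
    passes from [S] to Laurent polynomials over [S]; the ring itself is formed only at the end, by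
    [units_subdomain]. *)
Definition parametrizes_units (K : fieldType) (S : {pred K}) (H : groupType)
    (f : H -> K) : Prop :=
  [/\ {morph f : x y / (x * y)%g >-> x * y}, injective f,
      forall h, [/\ f h != 0, f h \in S & (f h)^-1 \in S]
    & forall x, x != 0 -> x \in S -> x^-1 \in S -> exists h, f h = x].

Lemma units_subdomain (K : fieldType) (S : subringClosed K) (H : groupType) (f : H -> K) :
  parametrizes_units S f -> isomorphic H (units (subdomain S)).
Proof.
case=> fM f_inj fU f_surj.
have gS h : f h \in S by case: (fU h).
pose g h : subdomain S := exist _ (f h) (gS h).
have gU h : g h \is a GRing.unit by apply/andP; split; case: (fU h).
exists (fun h => MkUnits (gU h)) => [x y|].
  by apply/val_inj/val_inj; rewrite /= fM.
apply: bijective_of_inj_surj => [x y /(congr1 val)/(congr1 val)/= /f_inj//|u].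
have /andP[u0 uVS] := valP u.
have [h fh] := f_surj _ u0 (valP (val u)) uVS.
by exists h; apply/val_inj/val_inj.
Qed.

Lemma int_le_addn (a b : int) : a <= b -> exists n : nat, b = a + n%:Z.
Proof. by move=> ab; exists `|b - a|%N; rewrite gez0_abs ?subr_ge0 // subrKC. Qed.

(** * Monomials with integer exponents in a field *)

Section FieldPowers.
Variables (F : fieldType) (x : F).
Hypothesis x0 : x != 0.

Lemma mulf_exprz_NegzK (a : F) n : a * x ^ Negz n * x ^+ n.+1 = a.
Proof. by rewrite NegzE -exprnN divfK // expf_neq0. Qed.

Lemma mulf_exprzD (a b : F) (k l : int) : a * b * x ^ (k + l) = a * x ^ k * (b * x ^ l).
Proof. by rewrite expfzDr // mulrACA. Qed.

Lemma mulf_exprz_cancel (a b : F) (k : int) (n : nat) :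
  a * x ^ k = b * x ^ (k + n%:Z) -> a = b * x ^+ n.
Proof.
by rewrite expfzDr // mulrA mulrAC => /(mulIf (expfz_neq0 _ x0)); rewrite -exprnP.
Qed.

Lemma mulf_exprzV (a b : F) (k : int) : a * b = 1 -> (a * x ^ k)^-1 = b * x ^ (- k).
Proof. by move=> ab; apply: mulr1_eq; rewrite -mulf_exprzD ab mul1r subrr. Qed.

Lemma mulf_exprzB (a y : F) (i n : nat) : y * x ^+ n = a * x ^+ i -> a * x ^ (i%:Z - n%:Z) = y.
Proof.
by move=> yE; apply: (mulIf (expf_neq0 n x0)); rewrite yE -mulrA !exprnP -expfzDr // subrK.
Qed.

End FieldPowers.

(** * Laurent polynomials over a subring of a field *)

Section Laurent.
Variables (K : fieldType) (S : subringClosed K).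
Local Notation "p %:F" := (tofrac p).

Lemma tofrac_inj : injective (@tofrac {poly K}).
Proof. by move=> p q /eqP; rewrite tofrac_eq => /eqP. Qed.

Lemma tofracX_neq0 : ('X%:F : {fraction {poly K}}) != 0.
Proof. by rewrite tofrac_eq0 polyX_eq0. Qed.

(** The ring [S[X, X^-1]] inside the field [K(X)]. *)
Definition laurent : {pred {fraction {poly K}}} :=
  fun x => `[< exists n, exists2 p, p \is a polyOver S & x * 'X%:F ^+ n = p%:F >].

Fact laurent_subring_closed : subring_closed laurent.
Proof.
split.
- by apply/asboolP; exists 0, 1; rewrite ?rpred1 // mulr1 tofrac1.
- move=> x y /asboolP[n [p Sp xp]] /asboolP[m [q Sq yq]]; apply/asboolP.
  exists (n + m)%N, (p * 'X^m - q * 'X^n).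
    by rewrite rpredB // rpredM // rpredX // polyOverX.
  by rewrite mulrBl {2}addnC !exprD !mulrA xp yq -!tofracXn -!tofracM -tofracB.
- move=> x y /asboolP[n [p Sp xp]] /asboolP[m [q Sq yq]]; apply/asboolP.
  exists (n + m)%N, (p * q); first by rewrite rpredM.
  by rewrite exprD mulrACA xp yq tofracM.
Qed.

HB.instance Definition _ :=
  GRing.isSubringClosed.Build {fraction {poly K}} laurent laurent_subring_closed.

Definition laurent_monomial (H : groupType) (f : H -> K) (x : H * int) :=
  (f x.1)%:P%:F * 'X%:F ^ x.2.

(** ['X] is irreducible, so the divisors of its powers are its powers up to a constant. *)
Lemma monomial_cofactor (p q : {poly K}) n : p * q = 'X^n ->
  exists c i, [/\ c != 0, (i <= n)%N & p = c *: 'X^i].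
Proof.
move=> pq.
have : p %| 'X^n by apply/dvdpP; exists q; rewrite mulrC.
rewrite -['X]subr0 => /dvdp_exp_XsubCP[i [le_in]]; rewrite subr0.
case/eqpP => -[a b] /= /andP[a0 b0] E; exists (a^-1 * b), i; split => //.
  by rewrite mulf_neq0 ?invr_neq0.
by rewrite -scalerA -E scalerA mulVf // scale1r.
Qed.

(** If [x] and its inverse are Laurent polynomials, clearing denominators gives polynomials [p] and
    [q] whose product is a power of ['X]. Both are then monomials, and their coefficients are
    inverse to each other in [S]. *)
Lemma parametrizes_units_laurent (H : groupType) (f : H -> K) :
  parametrizes_units S f ->
  parametrizes_units laurent (laurent_monomial f : H * Algebra.to_multiplicative int -> _).
Proof.
case=> fM f_inj fU f_surj.
have X0 := tofracX_neq0.
have f0 h : f h != 0 by case: (fU h).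
have fX0 h : (f h)%:P%:F != 0 by rewrite tofrac_eq0 polyC_eq0.
have mon_laurent c (z : int) : c \in S -> c%:P%:F * 'X%:F ^ z \in laurent.
  move=> cS; apply/asboolP; case: z => n.
    exists 0, (c%:P * 'X^n); last by rewrite mulr1 tofracM tofracXn.
    by rewrite rpredM ?polyOverC ?rpredX ?polyOverX.
  exists n.+1, c%:P; first by rewrite polyOverC.
  exact: (mulf_exprz_NegzK X0).
split.
- move=> [h z] [h' z']; rewrite /laurent_monomial /= fM polyCM tofracM.
  exact: (mulf_exprzD X0).
- move=> [h z] [h' z']; rewrite /laurent_monomial /=.
  wlog le_z : h z h' z' / z <= z' => [W|].
    by case/orP: (le_total z z') => le_z E; [|apply/esym]; apply: W.
  have [n ->] := int_le_addn le_z.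
  move=> /(mulf_exprz_cancel X0); rewrite -tofracXn -tofracM => /tofrac_inj.
  (* Unequal exponents are excluded by evaluating at 0. *)
  case: n => [|n] E.
    by rewrite mulr1 in E; move/polyC_inj/f_inj: E => ->; rewrite addr0.
  move/(congr1 (fun p : {poly K} => p.[0])): E; rewrite !hornerE expr0n mulr0 => /eqP.
  by rewrite (negPf (f0 h)).
- move=> [h z]; rewrite /laurent_monomial /=; case: (fU h) => _ hS hVS; split.
  + exact: (mulf_neq0 (fX0 h) (expfz_neq0 z X0)).
  + exact: mon_laurent.
  + suff -> : ((f h)%:P%:F * 'X%:F ^ z)^-1 = (f h)^-1%:P%:F * 'X%:F ^ (- z).
      exact: mon_laurent.
    by apply: (mulf_exprzV X0); rewrite -tofracM -polyCM mulfV // tofrac1.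
- move=> x x0 /asboolP[n [p Sp xp]] /asboolP[m [q Sq xq]].
  have pq : p * q = 'X^(n + m).
    by apply: tofrac_inj; rewrite tofracM -xp -xq mulrACA mulfV // mul1r -exprD tofracXn.
  have [c [i [c0 _ pE]]] := monomial_cofactor pq.
  have [c' [j [c'0 _ qE]]] := monomial_cofactor (etrans (mulrC _ _) pq).
  have cc' : c * c' = 1.
    move/(congr1 (horner^~ 1)): pq.
    by rewrite /= pE qE !(hornerM, hornerZ, hornerXn) !expr1n !mulr1.
  have lc (r : {poly K}) a k : r = a *: 'X^k -> r \is a polyOver S -> a \in S.
    by move=> -> /polyOverP/(_ k); rewrite coefZ coefXn eqxx mulr1.
  have [|h fh] := f_surj c c0 (lc _ _ _ pE Sp).
    by rewrite (mulr1_eq cc') (lc _ _ _ qE Sq).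
  exists (h, i%:Z - n%:Z); rewrite /laurent_monomial /= fh.
  by apply: (mulf_exprzB X0); rewrite xp pE -mul_polyC tofracM tofracXn.
Qed.

End Laurent.

Lemma free_abelian_0 (H : groupType) : isomorphic H (H * free_abelian 0)%type.
Proof.
exists (fun h => (h, 0 : 'rV[int]_0)) => [x y|].
  by congr (_, _); apply/matrixP => i [].
exists fst => // -[h v]; congr (_, _); by apply/matrixP => i [].
Qed.

Lemma row_mx_constD g (k l : int) (v w : 'rV[int]_g) :
  row_mx (const_mx (k + l)) (v + w) =
  row_mx (const_mx k) v + row_mx (const_mx l) w :> 'rV_(1 + g).
Proof. by rewrite add_row_mx; congr row_mx; apply/matrixP => i j; rewrite !mxE. Qed.

Lemma free_abelian_S (H : groupType) g :
  isomorphic (H * free_abelian g * Algebra.to_multiplicative int)%type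
             (H * free_abelian g.+1)%type.
Proof.
exists (fun x => (x.1.1, row_mx (const_mx x.2) x.1.2 : 'rV[int]_(1 + g))).
  by move=> x y; congr (_, _); apply: row_mx_constD.
exists (fun x => ((x.1, rsubmx (x.2 : 'rV[int]_(1 + g))), lsubmx (x.2 : 'rV[int]_(1 + g)) 0 0)).
  by move=> [[h v] z]; rewrite /= row_mxKr row_mxKl mxE.
move=> [h v] /=; congr (_, _); rewrite -[RHS]hsubmxK; congr row_mx.
by apply/matrixP => i j; rewrite mxE !ord1.
Qed.

Lemma isomorphic_trans (G H L : groupType) :
  isomorphic G H -> isomorphic H L -> isomorphic G L.
Proof.
case=> f fM fB [g gM gB]; exists (g \o f); last exact: bij_comp.
by move=> x y; rewrite /= fM gM.
Qed.

Lemma isomorphic_sym (G H : groupType) : isomorphic G H -> isomorphic H G.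
Proof.
case=> f fM [g fK gK]; exists g; last by exists f.
by move=> x y; apply: (can_inj fK); rewrite fM !gK.
Qed.

Lemma isomorphic_prod (G G' H H' : groupType) : isomorphic G G' -> isomorphic H H' ->
  isomorphic (G * H)%type (G' * H')%type.
Proof.
case=> f fM [f' fK f'K] [g gM [g' gK g'K]].
exists (fun x => (f x.1, g x.2)) => [[a b] [a' b']|].
  by congr (_, _); [apply: fM | apply: gM].
by exists (fun x => (f' x.1, g' x.2)) => -[a b]; rewrite /= ?fK ?gK ?f'K ?g'K.
Qed.

Lemma parametrizes_units_iso (K : fieldType) (S : {pred K}) (G H : groupType) (f : H -> K) :
  isomorphic G H -> parametrizes_units S f -> exists f' : G -> K, parametrizes_units S f'.
Proof.
case=> g gM [g' gK g'K] [fM f_inj fU f_surj]; exists (f \o g); split => /=.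
- by move=> x y; rewrite /= gM fM.
- by move=> x y /= /f_inj /(can_inj gK).
- by move=> h; apply: fU.
- by move=> x x0 Sx SxV; have [h <-] := f_surj x x0 Sx SxV; exists (g' h); rewrite g'K.
Qed.

(** Each Laurent variable contributes one factor [Z]. The induction carries the field, the subring
    and the parametrization, from which the next variable is adjoined. *)
Lemma units_laurent_domain (K : fieldType) (S : subringClosed K) (H : groupType) (f : H -> K) g :
  parametrizes_units S f ->
  exists A : idomainType, [pchar A] =i [pchar K] /\
    isomorphic (H * free_abelian g)%type (units A).
Proof.
move=> fP.
suff [K' [S' [f' [charK' fP']]]] : exists (K' : fieldType) (S' : subringClosed K')
    (f' : H * free_abelian g -> K'), [pchar K'] =i [pchar K] /\ parametrizes_units S' f'.
  exists (subdomain S'); split; last exact: units_subdomain fP'.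
  by move=> p; rewrite subdomain_pchar charK'.
elim: g => [|g [K' [S' [f' [charK' fP']]]]].
  have [f' fP'] := parametrizes_units_iso (isomorphic_sym (free_abelian_0 H)) fP.
  by exists K, S, f'.
have [f'' fP''] := parametrizes_units_iso (isomorphic_sym (free_abelian_S H g))
  (parametrizes_units_laurent fP').
exists {fraction {poly K'}}, (laurent S' : subringClosed _), f''; split; last exact: fP''.
move=> p; rewrite -charK' !inE; congr (_ && _).
by rewrite -tofrac1 -tofracMn tofrac_eq0 -polyC1 -polyCMn polyC_eq0.
Qed.

(** * Units of the ring generated by a root of unity *)

Definition zring (z : algC) : {pred algC} :=
  fun x => `[< exists p : {poly int}, x = (map_poly intr p).[z] >].

Section ZRing.
Variable z : algC.

Lemma zringP x : reflect (exists p : {poly int}, x = (map_poly intr p).[z]) (x \in zring z).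
Proof. exact: asboolP. Qed.

Fact zring_subring_closed : subring_closed (zring z).
Proof.
split.
- by apply/zringP; exists 1; rewrite rmorph1 hornerC.
- move=> _ _ /zringP[p ->] /zringP[q ->]; apply/zringP; exists (p - q).
  by rewrite rmorphB hornerD hornerN.
- move=> _ _ /zringP[p ->] /zringP[q ->]; apply/zringP; exists (p * q).
  by rewrite rmorphM hornerM.
Qed.

HB.instance Definition _ := GRing.isSubringClosed.Build algC (zring z) zring_subring_closed.

Lemma zring_gen : z \in zring z.
Proof. by apply/zringP; exists 'X; rewrite map_polyX hornerX. Qed.

Lemma rmorph_zpoly (f : {rmorphism algC -> algC}) (p : {poly int}) x :
  f (map_poly intr p).[x] = (map_poly intr p).[f x].
Proof.
rewrite -horner_map -map_poly_comp; congr (_.[_]).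
by apply: eq_map_poly => i; apply: rmorph_int.
Qed.

Lemma rmorph_zring_eq (f g : {rmorphism algC -> algC}) :
  f z = g z -> {in zring z, f =1 g}.
Proof. by move=> fgz _ /zringP[p ->]; rewrite !rmorph_zpoly fgz. Qed.

Lemma rmorph_zring_stable (f : {rmorphism algC -> algC}) :
  f z \in zring z -> {in zring z, forall x, f x \in zring z}.
Proof.
move=> /zringP[q fz] _ /zringP[p ->]; apply/zringP; exists (p \Po q).
by rewrite rmorph_zpoly fz map_comp_poly horner_comp.
Qed.

End ZRing.

(** * Pigeonhole principle and estimates for complex numbers *)

Lemma box_pigeonhole (T I : finType) (r : T -> I -> algC) (B : algC) (K : nat) :
  0 < B -> (forall t i, r t i \is Num.real) -> (forall t i, `|r t i| <= B) ->
  (0 < K)%N -> (K ^ #|I| < #|T|)%N ->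
  exists s t, s != t /\ forall i, `|r s i - r t i| <= 3 * B / K%:R.
Proof.
move=> B0 rR rB K0 KT.
have K0' : (0 : algC) < K%:R by rewrite ltr0n.
(* Scaling by [3 * B] instead of [2 * B] makes the rescaled values strictly smaller than [K], so
   that truncation lands in ['I_K]. *)
pose k := K%:R / (3 * B).
have B3 : 0 < 3 * B by rewrite mulr_gt0.
have k0 : 0 < k by rewrite divr_gt0.
pose u t i := (r t i + B) * k.
have /all_and2[u0 uK] ti : 0 <= u ti.1 ti.2 /\ u ti.1 ti.2 < K%:R.
  have := rB ti.1 ti.2; rewrite real_ler_norml ?rR // => /andP[Br rB'].
  split; first by rewrite mulr_ge0 ?(ltW k0) // -[B]opprK subr_ge0.
  rewrite /u /k mulrA ltr_pdivrMr // [ltRHS]mulrC ltr_pM2r //.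
  apply: (@le_lt_trans _ _ (B + B)); first by rewrite lerD2r.
  by rewrite (_ : 3 * B = B + B + B) ?ltrDl //; ring.
have uKn t i : (Num.truncn (u t i) < K)%N.
  by rewrite truncn_lt_nat ?(u0 (t, i)) ?(uK (t, i)).
pose f t := [ffun i => Ordinal (uKn t i)].
have /injectivePn[s [t st fst]] : ~~ injectiveb f.
  apply: contraL KT => /injectiveP/leq_card.
  by rewrite card_ffun card_ord -leqNgt.
exists s, t; split => // i.
have /(congr1 val)/= E : Ordinal (uKn s i) = Ordinal (uKn t i).
  by have /ffunP/(_ i) := fst; rewrite !ffunE.
have := truncn_itv (u0 (s, i)); have := truncn_itv (u0 (t, i)); rewrite /= -E.
move: (Num.truncn _) => n /andP[n1 n2] /andP[n3 n4].
have uR t' i' : u t' i' \is Num.real by rewrite ger0_real // (u0 (t', i')).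
have : `|u s i - u t i| <= 1.
  rewrite real_ler_norml ?rpredB //; apply/andP; split.
    rewrite lerNl opprB lerBlDr (le_trans (ltW n2)) // -natr1 addrC.
    by rewrite lerD2l.
  by rewrite lerBlDr (le_trans (ltW n4)) // -natr1 addrC lerD2l.
rewrite -mulrBl opprD addrACA subrr addr0 normrM (gtr0_norm k0).
by rewrite -ler_pdivlMr // div1r invf_div.
Qed.

Lemma norm_Re_le (w : algC) : `|'Re w| <= `|w|.
Proof. exact: (leif_normC_Re_Creal w). Qed.

Lemma norm_Im_le (w : algC) : `|'Im w| <= `|w|.
Proof.
rewrite -(@ler_pXn2r _ 2) ?nnegrE // (normC2_Re_Im w) real_normK ?Creal_Im //.
by rewrite lerDr real_exprn_even_ge0 ?Creal_Re.
Qed.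

(** [algC] is only partially ordered; in place of a minimum, the inverse of [1 + \sum_i (f i)^-1]
    serves as the bound. *)
Lemma finite_pos_lower_bound (I : finType) (f : I -> algC) :
  (forall i, 0 < f i) -> exists2 e, 0 < e & forall i, e <= f i.
Proof.
move=> f0; have S0 : 0 <= \sum_i (f i)^-1.
  by apply: sumr_ge0 => i _; rewrite invr_ge0 ltW.
have S1 : 0 < 1 + \sum_i (f i)^-1 by apply: ltr_wpDr.
exists (1 + \sum_i (f i)^-1)^-1; first by rewrite invr_gt0.
move=> i; rewrite -[leRHS]invrK lef_pV2 ?posrE ?invr_gt0 //.
rewrite (bigD1 i) //= addrCA lerDl addr_ge0 // sumr_ge0 // => j _.
by rewrite invr_ge0 ltW.
Qed.

(** * Galois action, norm and coordinates on the ring generated by a primitive root of unity *)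

Section CyclotomicRing.
Variables (m : nat) (z : algC).
Hypotheses (m_gt1 : (1 < m)%N) (prim_z : m.-primitive_root z).

Local Notation G := {unit 'Z_m}.
Local Notation d := (totient m).
Local Notation O := (zring z).

Let m_gt0 : (0 < m)%N. Proof. exact: ltnW. Qed.

Lemma card_unit_Zp : #|{: G}| = d.
Proof. by rewrite -(card_units_Zp m_gt0) cardsT. Qed.

Definition uexp (g : G) : nat := (val g : 'Z_m).

Lemma uexp_lt g : (uexp g < m)%N.
Proof. by rewrite -[X in (_ < X)%N](Zp_cast m_gt1); apply: ltn_ord. Qed.

Lemma uexp_coprime g : coprime (uexp g) m.
Proof. by rewrite coprime_sym -unitZpE // /uexp natr_Zp (valP g). Qed.

Lemma uexp_inj : injective uexp.
Proof. by move=> g h /val_inj/val_inj. Qed.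

Lemma uexpM g h : uexp (g * h) = ((uexp g * uexp h) %% m)%N.
Proof. by rewrite /uexp FinRing.val_unitM /=; congr (_ %% _)%N; apply: Zp_cast. Qed.

(** A chosen ring endomorphism of all of [algC] raising [m]-th roots of unity to the power [uexp g].
    Only its restriction to [zring z] is determined, whence the membership hypotheses in [sigmaM]
    and [sigma1]. *)
Definition sigma (g : G) : {rmorphism algC -> algC} := sval (Qn_aut_exists (uexp_coprime g)).

Lemma sigma_gen g : sigma g z = z ^+ uexp g.
Proof. by rewrite /sigma; case: Qn_aut_exists => f /= fP; apply/fP/(prim_expr_order prim_z). Qed.

Lemma sigma_zring g x : x \in zring z -> sigma g x \in zring z.
Proof. by apply: rmorph_zring_stable; rewrite sigma_gen rpredX ?zring_gen. Qed.

Lemma sigmaM g h x : x \in zring z -> sigma (g * h)%g x = sigma g (sigma h x).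
Proof.
apply: (@rmorph_zring_eq z (sigma (g * h)%g) (sigma g \o sigma h)) => /=.
by rewrite !sigma_gen rmorphXn /= sigma_gen uexpM prim_expr_mod // exprM.
Qed.

Lemma sigma1 x : x \in zring z -> sigma 1 x = x.
Proof.
apply: (@rmorph_zring_eq z (sigma 1) idfun) => /=.
by rewrite sigma_gen /uexp FinRing.val_unit1 /= modn_small ?Zp_cast.
Qed.

Definition minus1 : G := FinRing.Unit (unitrN1 'Z_m).

Lemma minus1C g : (minus1 * g = g * minus1)%g.
Proof. by apply: val_inj; rewrite !FinRing.val_unitM mulrC. Qed.

Lemma minus1_sqr : (minus1 * minus1 = 1)%g.
Proof. by apply: val_inj; rewrite FinRing.val_unitM FinRing.val_unit1 /= mulrNN mulr1. Qed.

Lemma norm_gen : `|z| = 1.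
Proof.
have : `|z| ^+ m = 1 by rewrite -normrX (prim_expr_order prim_z) normr1.
by move/eqP; rewrite pexpr_eq1 // => /eqP.
Qed.

(** As [z] has absolute value 1, both maps send it to its inverse. *)
Lemma sigma_minus1 x : x \in zring z -> sigma minus1 x = x^*.
Proof.
apply: (@rmorph_zring_eq z (sigma minus1) Num.conj) => /=.
have z0 : z != 0 by rewrite -normr_eq0 norm_gen oner_eq0.
apply: (mulIf z0); rewrite sigma_gen mulrC -exprS mulrC -normCK norm_gen expr1n.
rewrite -(prim_expr_mod prim_z) -[RHS](expr0 z); congr (_ ^+ _).
have : ((uexp minus1).+1%:R : 'Z_m) = 0 by rewrite mulrSr natr_Zp addNr.
by move/(congr1 (@nat_of_ord _)); rewrite val_Zp_nat.
Qed.

Lemma conj_zring x : x \in zring z -> x^* \in zring z.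
Proof. by move=> xO; rewrite -sigma_minus1 ?sigma_zring. Qed.

Lemma sigma_conj g x : x \in zring z -> sigma g x^* = (sigma g x)^*.
Proof.
by move=> xO; rewrite -!sigma_minus1 ?sigma_zring // -!sigmaM // minus1C.
Qed.

(** The coordinates are those of the remainder modulo the monic polynomial ['Phi_m], which vanishes
    at [z]. *)
Lemma zring_coords x : x \in zring z ->
  exists a : 'rV[int]_d, x = \sum_i (a 0 i)%:~R * z ^+ i.
Proof.
move=> /zringP[p ->]; pose r := Pdiv.CommonRing.rmodp p 'Phi_m.
have sz_r : (size r <= d)%N.
  rewrite -ltnS -size_Cyclotomic; apply: Pdiv.CommonRing.ltn_rmodpN0.
  by rewrite monic_neq0 ?Cyclotomic_monic.
exists (\row_i r`_i).
rewrite (Pdiv.RingMonic.rdivp_eq (Cyclotomic_monic m) p) -/r rmorphD rmorphM /=.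
rewrite (Cintr_Cyclotomic prim_z) !hornerE.
have /rootP-> : root (cyclotomic z m) z by rewrite root_cyclotomic.
rewrite mulr0 add0r (@horner_coef_wide _ d).
  by apply: eq_bigr => i _; rewrite coef_map mxE.
exact: leq_trans (size_poly _ _) sz_r.
Qed.

(** The [d] powers [z ^+ uexp g] are distinct, too many roots for a nonzero polynomial of degree
    less than [d]. Through [sigma], this yields the linear independence of [1, z, ..., z^(d-1)] over
    the integers. *)
Lemma conjugate_roots (p : {poly algC}) : (size p <= d)%N ->
  (forall g : G, p.[z ^+ uexp g] = 0) -> p = 0.
Proof.
move=> sz_p p0; apply/eqP; apply: contraTT sz_p => pN0; rewrite -ltnNge.
have -> : d = size [seq z ^+ uexp g | g <- enum {: G}].
  by rewrite size_map -cardE card_unit_Zp.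
apply: max_poly_roots => //.
  by apply/allP => _ /mapP[g _ ->]; apply/rootP.
rewrite map_inj_uniq ?enum_uniq // => g h /eqP.
rewrite (eq_prim_root_expr prim_z) !modn_small ?uexp_lt // => /eqP; exact: uexp_inj.
Qed.

Lemma horner_rVpoly_coords (a : 'rV[algC]_d) y :
  (rVpoly a).[y] = \sum_i a 0 i * y ^+ i.
Proof.
rewrite (@horner_coef_wide _ d) ?size_poly //.
by apply: eq_bigr => i _; rewrite coef_rVpoly_ord.
Qed.

Lemma sigma_coords g (a : 'rV[int]_d) :
  sigma g (\sum_i (a 0 i)%:~R * z ^+ i) = \sum_i (a 0 i)%:~R * (z ^+ uexp g) ^+ i.
Proof.
by rewrite rmorph_sum; apply: eq_bigr => i _; rewrite rmorphM rmorph_int rmorphXn /= sigma_gen.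
Qed.

(* [x] is the value at [z] of a polynomial of degree < d; subtracting [x] yields
   one with [d] roots, so the polynomial is constant. *)
Lemma sigma_fixed_int x : x \in zring z -> (forall g, sigma g x = x) -> x \in Num.int.
Proof.
move=> xO xfix; have [a xE] := zring_coords xO.
have d_gt0 : (0 < d)%N by rewrite totient_gt0.
have /polyP/(_ 0) : rVpoly (map_mx intr a) - x%:P = 0.
  apply: conjugate_roots.
    rewrite (leq_trans (size_polyD _ _)) // geq_max size_poly size_polyN.
    by rewrite (leq_trans (size_polyC_leq1 _)).
  move=> g; rewrite hornerD hornerN hornerC -(xfix g) xE sigma_coords.
  by rewrite horner_rVpoly_coords; under eq_bigr do rewrite mxE; rewrite subrr.
rewrite coefB coefC coef0 /= (coef_rVpoly_ord _ (Ordinal d_gt0)) mxE => /eqP.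
by rewrite subr_eq0 => /eqP<-; apply: intr_int.
Qed.

(** On [zring z], the norm from [Q(z)] to [Q]. *)
Definition cnorm x := \prod_(g : G) sigma g x.

Lemma cnorm_int x : x \in zring z -> cnorm x \in Num.int.
Proof.
move=> xO; apply: sigma_fixed_int.
  by apply: rpred_prod => g _; apply: sigma_zring.
move=> g; rewrite rmorph_prod /= [RHS](reindex_inj (mulgI g)) /=.
by apply: eq_bigr => h _; rewrite sigmaM.
Qed.

Lemma cnormM x y : cnorm (x * y) = cnorm x * cnorm y.
Proof. by rewrite /cnorm -big_split; apply: eq_bigr => g _; rewrite rmorphM. Qed.

Lemma cnorm_eq0 x : (cnorm x == 0) = (x == 0).
Proof.
apply/idP/eqP => [/prodf_eq0[g _]|->]; first by rewrite fmorph_eq0 => /eqP.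
by rewrite /cnorm (bigD1 1%g) //= rmorph0 mul0r.
Qed.

Lemma cnorm_cofactor x : x \in zring z -> exists2 y, y \in zring z & cnorm x = x * y.
Proof.
move=> xO; exists (\prod_(g : G | g != 1%g) sigma g x).
  by apply: rpred_prod => g _; apply: sigma_zring.
by rewrite /cnorm (bigD1 1%g) //= sigma1.
Qed.

(* The embeddings at which a fundamental unit has to be small. *)
Definition generic (g : G) := (g != 1%g) && (g != minus1).

Lemma generic_minus1 g : generic (minus1 * g)%g = generic g.
Proof.
rewrite /generic andbC; congr (~~ _ && ~~ _).
  by rewrite -{2}[minus1]mulg1 (inj_eq (mulgI minus1)).
by rewrite -(inj_eq (mulgI minus1) g) minus1_sqr.
Qed.

(* One real number per embedding: since conjugate embeddings share their real
   part and have opposite imaginary parts, the pair of values of [rho] at [g]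
   and [minus1 * g] determines [sigma g x]. *)
Definition rho (g : G) x := 'Re (sigma g x) + 'Im (sigma g x).

Lemma rho_real g x : rho g x \is Num.real.
Proof. by rewrite rpredD. Qed.

Lemma rhoB g x y : rho g (x - y) = rho g x - rho g y.
Proof. by rewrite /rho !raddfB /= opprD addrACA. Qed.

Lemma sigma_le_rho g x : x \in O -> `|sigma g x| <= `|rho g x| + `|rho (minus1 * g) x|.
Proof.
move=> xO; rewrite /rho sigmaM // sigma_minus1 ?sigma_zring // Re_conj Im_conj.
set w := sigma g x; rewrite {1}[w]Crect.
have E1 : 'Re w = ('Re w + 'Im w) / 2 + ('Re w - 'Im w) / 2 by field.
have E2 : 'Im w = ('Re w + 'Im w) / 2 - ('Re w - 'Im w) / 2 by field.
apply: le_trans (ler_normD _ _) _; rewrite normrM normCi mul1r.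
move: E1 E2; set a := _ + 'Im w; set b := _ - 'Im w => -> ->.
have := lerD (ler_normD (a / 2) (b / 2)) (ler_normB (a / 2) (b / 2)).
move/le_trans; apply; rewrite !normrM !normfV !normr_nat.
by rewrite le_eqVlt; apply/orP; left; apply/eqP; field.
Qed.

Definition coords_eval (a : 'rV[int]_d) := \sum_i (a 0 i)%:~R * z ^+ i.

Lemma coords_eval_zring a : coords_eval a \in O.
Proof. by apply: rpred_sum => i _; rewrite rpredM ?rpred_int ?rpredX ?zring_gen. Qed.

Lemma coords_evalB a b : coords_eval (a - b) = coords_eval a - coords_eval b.
Proof.
rewrite /coords_eval -sumrB; apply: eq_bigr => i _.
by rewrite !mxE rmorphB mulrBl.
Qed.

Lemma coords_eval_inj : injective coords_eval.
Proof.
move=> a b ab; apply/eqP; rewrite -subr_eq0; apply/eqP.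
have {ab} ab0 : coords_eval (a - b) = 0 by rewrite coords_evalB ab subrr.
have : rVpoly (map_mx intr (a - b) : 'rV[algC]_d) = 0.
  apply: conjugate_roots; first exact: size_poly.
  move=> g; rewrite horner_rVpoly_coords; under eq_bigr do rewrite mxE.
  by rewrite -sigma_coords -/(coords_eval _) ab0 rmorph0.
move=> /polyP p0; apply/rowP => i; have := p0 i.
rewrite coef_rVpoly_ord coef0 mxE => /eqP; rewrite intr_eq0 => /eqP->.
by rewrite mxE.
Qed.

(** * Construction of a unit that is small at the generic embeddings *)

Lemma sigma_coords_le g (a : 'rV[int]_d) (B : algC) : (forall i, `|(a 0 i)%:~R| <= B) ->
  `|sigma g (coords_eval a)| <= d%:R * B.
Proof.
move=> aB; rewrite sigma_coords (le_trans (ler_norm_sum _ _ _)) //.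
rewrite mulr_natl -[X in _ *+ X]card_ord -sumr_const ler_sum // => i _.
by rewrite normrM !normrX norm_gen !expr1n mulr1.
Qed.

Lemma card_generic : (#|generic| < d)%N.
Proof.
rewrite -card_unit_Zp; apply: proper_card; apply/properP; split; first exact: subset_predT.
by exists 1%g; rewrite // unfold_in /generic eqxx.
Qed.

(* Pigeonhole with [n0 = #|generic|], coordinates in [0, t^n0] and [t^d] boxes
   for each generic embedding: the small conjugates are O(t^(n0 - d)) and the
   others O(t^n0), so that the powers of [t] cancel in the norm. *)
Lemma small_element : exists C : nat, forall t : nat, (0 < t)%N ->
  exists x, [/\ x \in O, x != 0, `|cnorm x| <= C%:R
              & forall g, generic g -> `|sigma g x| <= C%:R / t%:R].
Proof.
pose n0 := #|generic|; have n0d := card_generic; rewrite -/n0 in n0d.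
have d0 : (0 < d)%N by apply: leq_ltn_trans n0d.
(* All conjugates are at most [D], so [rho] is at most [2 * D]; the pigeonhole bounds differences of
   [rho] by [6 * D / K], and two values of [rho] bound a conjugate, which gives 12. The same 12 is
   used at the other embeddings, and then [K ^ n0 = M ^ d] makes the norm bound [(12 * d) ^ d]. *)
exists ((12 * d) ^ d)%N => t t0.
pose M := (t ^ n0)%N; pose K := (t ^ d)%N.
have M0 : (0 < M)%N by rewrite expn_gt0 t0.
have K0 : (0 < K)%N by rewrite expn_gt0 t0.
pose c (a : {ffun 'I_d -> 'I_M.+1}) : 'rV[int]_d := \row_i (a i : nat)%:Z.
pose D : algC := d%:R * M%:R.
have D0 : 0 < D by rewrite mulr_gt0 ?ltr0n.
have sigma_le (a : {ffun 'I_d -> 'I_M.+1}) g : `|sigma g (coords_eval (c a))| <= D.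
  apply: sigma_coords_le => i; rewrite mxE -pmulrn normr_nat ler_nat -ltnS; exact: ltn_ord.
pose r (a : {ffun 'I_d -> 'I_M.+1}) (i : {g | generic g}) := rho (val i) (coords_eval (c a)).
have [|||||a [b [ab rab]]] := @box_pigeonhole _ _ r (2 * D) K.
- by rewrite mulr_gt0.
- by move=> a i; apply: rho_real.
- move=> a i; rewrite mulrDl mul1r; apply: le_trans (ler_normD _ _) _.
  by apply: lerD; [apply: le_trans (norm_Re_le _) _|apply: le_trans (norm_Im_le _) _].
- by [].
(* Coordinates take [M + 1] values, which makes the count strict: [K ^ n0 = M ^ d < M.+1 ^ d]. *)
- rewrite card_ffun !card_ord card_sig -/n0 (_ : K ^ n0 = M ^ d)%N ?ltn_exp2r //.
  by rewrite -!expnM mulnC.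
pose x := coords_eval (c a) - coords_eval (c b).
have xO : x \in O by rewrite rpredB ?coords_eval_zring.
have x_le_generic g : generic g -> `|sigma g x| <= 12 * D / K%:R.
  move=> gg; have gg' : generic (minus1 * g)%g by rewrite generic_minus1.
  apply: le_trans (sigma_le_rho _ xO) _.
  have := lerD (rab (exist (fun g => generic g) g gg)) (rab (exist (fun g => generic g) _ gg')).
  rewrite /r /= -!rhoB -/x => /le_trans; apply.
  by rewrite le_eqVlt; apply/orP; left; apply/eqP; field; rewrite pnatr_eq0 -lt0n.
have x_le g : `|sigma g x| <= 12 * D.
  rewrite rmorphB; apply: le_trans (ler_normB _ _) _.
  apply: le_trans (lerD (sigma_le a g) (sigma_le b g)) _.
  by rewrite -mulr2n -[D *+ 2]mulr_natl ler_wpM2r ?(ltW D0) // ler_nat.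
exists x; split => //.
- rewrite subr_eq0; apply: contra ab => /eqP/coords_eval_inj/rowP E.
  apply/eqP/ffunP => i; apply/val_inj; have := E i; rewrite !mxE; by case.
- rewrite normr_prod (bigID generic) /=.
  have -> : ((12 * d) ^ d)%:R = (12 * D / K%:R) ^+ n0 * (12 * D) ^+ (d - n0) :> algC.
    have KM : K%:R ^+ n0 = M%:R ^+ d :> algC by rewrite -!natrX -!expnM mulnC.
    rewrite expr_div_n mulrAC -exprD subnKC ?(ltnW n0d) // KM /D mulrA exprMn.
    rewrite mulfK; first by rewrite natrX natrM.
    by rewrite expf_neq0 // pnatr_eq0 -lt0n.
  have cardC : #|[pred g | ~~ generic g]| = (d - n0)%N.
    rewrite -card_unit_Zp -(cardC generic) addKn.
    by apply: eq_card => g; rewrite !inE.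
  rewrite -cardC -!prodr_const ler_pM ?prodr_ge0 //.
    by apply: ler_prod => g gg; rewrite normr_ge0 x_le_generic.
  by apply: ler_prod => g gg; rewrite normr_ge0 x_le.
- move=> g gg; apply: le_trans (x_le_generic g gg) _.
  rewrite ler_pdivrMr ?ltr0n // mulrAC ler_pdivlMr ?ltr0n //.
  rewrite /D -!natrM ler_nat (_ : 12 * (d * M) * t = (12 * d) * (M * t))%N; last by ring.
  apply: leq_mul; first by rewrite -[X in (X <= _)%N]expn1 leq_pexp2l ?muln_gt0.
  by rewrite -expnSr leq_pexp2l.
Qed.

Lemma sigma_neq0 g x : x != 0 -> sigma g x != 0.
Proof. by rewrite fmorph_eq0. Qed.

Lemma coords_evalZ (k : int) a : coords_eval (k *: a) = k%:~R * coords_eval a.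
Proof.
rewrite /coords_eval mulr_sumr; apply: eq_bigr => i _.
by rewrite mxE intrM mulrA.
Qed.

Lemma coords_congr_mod (Q : int) (a b : 'rV[int]_d) :
  (forall i, (a ord0 i = b ord0 i %[mod Q])%Z) ->
  exists2 c, c \in O & coords_eval a - coords_eval b = Q%:~R * c.
Proof.
move=> ab; exists (coords_eval (\row_i ((a ord0 i - b ord0 i) %/ Q)%Z)).
  exact: coords_eval_zring.
rewrite -coords_evalB -coords_evalZ; congr coords_eval.
apply/rowP => i; rewrite !mxE mulrC divzK //.
by have /eqP := ab i; rewrite eqz_mod_dvd.
Qed.

(** [x / y = 1 + c * (N / y)], and [N / y] is the product of the other conjugates of [y]. *)
Lemma quotient_zring (N : int) x y : x \in O -> y \in O -> y != 0 -> cnorm y = N%:~R ->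
  (exists2 c, c \in O & x - y = N%:~R * c) -> x / y \in O.
Proof.
move=> xO yO y0 yN [c cO xyc]; have [y' y'O yy'] := cnorm_cofactor yO.
rewrite -[x](subrK y) xyc -yN yy' mulrDl mulfV // -mulrA mulrAC mulrA.
by rewrite [y * _ / y]mulrAC mulfV // mul1r rpredD ?rpred1 // rpredM.
Qed.

(* In a sequence of elements of bounded norm with decreasing generic conjugates,
   two elements have the same norm and are congruent modulo it: their quotient
   is a unit. *)
Lemma minkowski_unit : exists u,
  [/\ u \in O, u^-1 \in O, u != 0, u^* = u & forall g, generic g -> `|sigma g u| < 1].
Proof.
have [C smallC] := small_element.
pose good x := [/\ x \in O, x != 0 & `|cnorm x| <= C%:R].
have [x0 [x0O x00 x0N _]] := smallC 1%N isT.
pose X := {x | good x}.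
have /choice[F FP] (x : X) : exists y : X,
    forall g, generic g -> `|sigma g (sval y)| < `|sigma g (sval x)|.
  have [e e0 eP] := @finite_pos_lower_bound _ (fun g => `|sigma g (sval x)|)
    (fun g => (etrans (normr_gt0 _) (sigma_neq0 g (let: And3 _ h _ := svalP x in h)))).
  (* With [t > C / e], the new generic conjugates, at most [C / t], fall below all the old ones. *)
  have [y [yO y0 yN yP]] := smallC (Num.truncn (C%:R / e)).+1 isT.
  exists (exist _ y (And3 yO y0 yN)) => g gg /=.
  apply: lt_le_trans (eP g); apply: le_lt_trans (yP g gg) _.
  rewrite ltr_pdivrMr ?ltr0n // mulrC -ltr_pdivrMr //.
  by rewrite real_truncnS_gt // rpred_div // ger0_real // ltW.
pose y0 : X := exist _ x0 (And3 x0O x00 x0N).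
pose alpha i := iter i F y0.
have chain i j g : (i < j)%N -> generic g ->
    `|sigma g (sval (alpha j))| < `|sigma g (sval (alpha i))|.
  move=> + gg; elim: j => // j IH; rewrite ltnS leq_eqVlt => /orP[/eqP->|/IH].
    exact: FP.
  by apply: lt_trans; apply: FP.
have /choice[cd cdP] (x : X) : exists an : 'rV[int]_d * int,
    sval x = coords_eval an.1 /\ cnorm (sval x) = an.2%:~R.
  have [xO _ _] := svalP x; have [a xa] := zring_coords xO.
  by have /intrP[n xn] := cnorm_int xO; exists (a, n).
(* Every norm that occurs is nonzero and at most [C] in absolute value, so it divides [Q]. The class
   of an element records its coordinates modulo [Q] and its norm, split into absolute value and
   sign. *)
pose Q := C`!.
have Q0 : (0 < Q)%N by apply: fact_gt0.
have modQ (k : int) : (`|(k %% Q)%Z| < Q)%N.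
  by rewrite -ltz_nat gez0_abs ?modz_ge0 ?ltz_mod // gt_eqF.
have normQ (x : X) : (`|(cd x).2| <= C)%N.
  have [_ xn] := cdP x; have [_ _] := svalP x.
  by rewrite xn -intr_norm -abszE -pmulrn ler_nat.
pose cls (i : nat) : {ffun 'I_d -> 'I_Q} * ('I_C.+1 * bool) :=
  ([ffun k => Ordinal (modQ ((cd (alpha i)).1 ord0 k))],
   (Ordinal (normQ (alpha i) : (_ < C.+1)%N), (cd (alpha i)).2 < 0)).
have [i [j [ltij clsij]]] : exists i j, (i < j)%N /\ cls i = cls j.
  pose n := #|{: {ffun 'I_d -> 'I_Q} * ('I_C.+1 * bool)}|.
  have /injectivePn[i [j ij cij]] : ~~ injectiveb (fun i : 'I_n.+1 => cls i).
    by apply/negP => /injectiveP/leq_card; rewrite card_ord ltnn.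
  have [lt_ij|lt_ji|/val_inj E] := ltngtP i j; first by exists i, j.
    by exists j, i.
  by rewrite E eqxx in ij.
set a := alpha i; set b := alpha j.
have [an bn] : (cd a).2 = (cd b).2 /\
    forall k, ((cd a).1 ord0 k = (cd b).1 ord0 k %[mod Q])%Z.
  move: clsij; rewrite /cls -/a -/b => -[/ffunP E1 E2 E3]; split.
    by rewrite [LHS]intEsign [RHS]intEsign E2 E3.
  move=> k; have := E1 k; rewrite !ffunE => /(congr1 val)/(congr1 Posz) /=.
  by rewrite !gez0_abs ?modz_ge0 // gt_eqF.
set N := (cd a).2 in an.
have [xO x_neq0 _] := svalP a; have [yO y_neq0 _] := svalP b.
have [xE xN] := cdP a; have [yE yN] := cdP b.
rewrite -an -/N in yN; rewrite -/N in xN.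
have N0 : N != 0.
  by apply: contra x_neq0 => /eqP N0; rewrite -cnorm_eq0 xN N0.
have /dvdnP[k QN] : (`|N| %| Q)%N.
  by rewrite dvdn_fact // absz_gt0 N0 normQ.
have /dvdzP[k' QN'] : (N %| Posz Q)%Z by rewrite dvdzE QN dvdn_mull.
have cong x y : (exists2 c, c \in O & x - y = Q%:~R * c) ->
    exists2 c, c \in O & x - y = N%:~R * c.
  move=> [c cO ->]; exists (k'%:~R * c); first by rewrite rpredM ?rpred_int.
  by rewrite QN' intrM mulrA [_ * k'%:~R]mulrC.
pose x := sval a; pose y := sval b.
have yxO : y / x \in O.
  apply: (@quotient_zring N) => //; apply: cong.
  by rewrite [y]yE [x]xE; apply: coords_congr_mod => k0; rewrite bn.
have xyO : x / y \in O.
  apply: (@quotient_zring N) => //; apply: cong.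
  by rewrite [y]yE [x]xE; apply: coords_congr_mod => k0; rewrite bn.
have yx0 : y / x != 0 by rewrite mulf_neq0 ?invr_eq0.
have w_lt1 g : generic g -> `|sigma g (y / x)| < 1.
  move=> gg; rewrite fmorph_div normf_div ltr_pdivrMr ?normr_gt0 ?sigma_neq0 //.
  by rewrite mul1r; apply: chain.
(* Multiplying by the complex conjugate makes the unit real and squares the absolute values of its
   conjugates. *)
exists (y / x * (y / x)^* ); split.
- by rewrite rpredM ?conj_zring.
- by rewrite invfM -fmorphV invf_div rpredM ?conj_zring.
- by rewrite mulf_neq0 ?conjC_eq0.
- by rewrite rmorphM /= conjCK mulrC.
- move=> g gg; rewrite rmorphM normrM sigma_conj // norm_conjC -expr2.
  by rewrite expr_lt1 // w_lt1.
Qed.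

(* The coordinates are recovered from the conjugates by a Vandermonde inverse. *)
Lemma zring_bounded_finite (B : algC) : exists F : seq algC,
  forall x, x \in O -> (forall g, `|sigma g x| <= B) -> x \in F.
Proof.
pose e (j : 'I_d) : G := enum_val (cast_ord (esym card_unit_Zp) j).
pose V : 'M[algC]_d := \matrix_(i, j) (z ^+ uexp (e j)) ^+ i.
have V_unit : V \in unitmx.
  rewrite -row_free_unit -kermx_eq0; apply/rowV0P => v /sub_kermxP vV.
  rewrite -[v]rVpolyK (_ : rVpoly v = 0) ?raddf0 //.
  apply: conjugate_roots; first exact: size_poly.
  move=> g; have /rowP/(_ (cast_ord card_unit_Zp (enum_rank g))) := vV.
  rewrite horner_rVpoly_coords !mxE => E; rewrite -[RHS]E; apply: eq_bigr => i _.
  by rewrite mxE /e cast_ordK enum_rankK.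
have [xB|xB] := pselect (exists2 x, x \in O & forall g, `|sigma g x| <= B); last first.
  by exists [::] => x xO xB'; case: xB; exists x.
have B0 : 0 <= B by case: xB => x _ /(_ 1%g); apply: le_trans.
pose c := B * \sum_i \sum_j `|invmx V i j|.
have c0 : 0 <= c by rewrite mulr_ge0 // !sumr_ge0 // => i _; rewrite sumr_ge0.
pose N := (Num.truncn c).+1.
pose dec (f : {ffun 'I_d -> 'I_(N.*2).+1}) : 'rV[int]_d := \row_i ((f i : nat)%:Z - N%:Z).
exists [seq coords_eval (dec f) | f : {ffun 'I_d -> 'I_(N.*2).+1}] => x xO {}xB.
have [a xa] := zring_coords xO.
have aE : map_mx intr a = (\row_j sigma (e j) x) *m invmx V.
  rewrite (_ : \row_j _ = map_mx intr a *m V) ?mulmxK //.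
  apply/rowP => j; rewrite !mxE xa sigma_coords; apply: eq_bigr => i _.
  by rewrite !mxE.
have aN i : `|a 0 i| <= N%:Z.
  rewrite -(ler_int algC) intr_norm.
  have -> : (a 0 i)%:~R = (map_mx intr a : 'rV[algC]_d) 0 i by rewrite mxE.
  rewrite aE mxE (le_trans (ler_norm_sum _ _ _)) //.
  apply: (@le_trans _ _ c); last by rewrite ltW // real_truncnS_gt ?ger0_real.
  rewrite /c mulr_sumr ler_sum // => j _; rewrite mxE normrM ler_pM //.
  by rewrite (bigD1 i) //= lerDl sumr_ge0.
have aN' i : (`|(a 0 i + N%:Z)%R| < (N.*2).+1)%N.
  rewrite ltnS -lez_nat abszE; apply: le_trans (ler_normD _ _) _.
  by rewrite -addnn PoszD lerD ?aN.
apply/imageP; exists [ffun i => Ordinal (aN' i)] => //.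
rewrite xa; congr coords_eval; apply/rowP => i; rewrite mxE ffunE /=.
rewrite gez0_abs ?addrK // -lerBlDr sub0r.
by have := aN i; rewrite ler_norml => /andP[].
Qed.

(** * Units of the cyclotomic ring and the subgroup generated by the conjugates of [u] *)

Definition is_cunit x := [&& x \in O, x^-1 \in O & x != 0].

Lemma is_cunitM x y : is_cunit x -> is_cunit y -> is_cunit (x * y).
Proof.
move=> /and3P[xO xVO x0] /and3P[yO yVO y0]; apply/and3P; split.
- exact: rpredM.
- by rewrite invfM rpredM.
- by rewrite mulf_neq0.
Qed.

Lemma is_cunitV x : is_cunit x -> is_cunit x^-1.
Proof. by move=> /and3P[xO xVO x0]; apply/and3P; rewrite invrK invr_eq0. Qed.

Lemma is_cunit1 : is_cunit 1.
Proof. by apply/and3P; rewrite invr1 rpred1 oner_eq0. Qed.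

Lemma is_cunit_sigma g x : is_cunit x -> is_cunit (sigma g x).
Proof.
move=> /and3P[xO xVO x0]; apply/and3P; split; first exact: sigma_zring.
  by rewrite -fmorphV sigma_zring.
by rewrite fmorph_eq0.
Qed.

Lemma is_cunit_prod (I : finType) (P : pred I) (F : I -> algC) :
  (forall i, P i -> is_cunit (F i)) -> is_cunit (\prod_(i | P i) F i).
Proof. by move=> FU; elim/big_ind: _ => //; [exact: is_cunit1|exact: is_cunitM]. Qed.

Lemma is_cunitX n x : is_cunit x -> is_cunit (x ^+ n).
Proof. by move=> xU; elim: n => [|n IH]; rewrite ?is_cunit1 // exprS is_cunitM. Qed.

Lemma cunit_norm x : is_cunit x -> `|cnorm x| = 1.
Proof.
move=> /and3P[xO xVO x0].
have /intrP[a aE] := cnorm_int xO; have /intrP[b bE] := cnorm_int xVO.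
have : cnorm (x * x^-1) = 1.
  by rewrite mulfV // /cnorm big1 // => g _; rewrite rmorph1.
rewrite cnormM aE bE -intrM => /eqP; rewrite -[1]/(1%:~R) eqr_int => /eqP ab.
have : (`|a| * `|b| = 1)%N by rewrite -abszM ab.
by move=> /eqP; rewrite muln_eq1 => /andP[/eqP a1 _]; rewrite -intr_norm -abszE a1.
Qed.

(** Absolute values are taken in [algR], which has the total order required in [LogLattice]. *)
Definition absR (x : algC) : algR := in_algR (normr_real x).

Lemma absRM : {morph absR : x y / x * y}.
Proof. by move=> x y; apply: val_inj; rewrite /= normrM. Qed.

Lemma absR1 : absR 1 = 1.
Proof. by apply: val_inj; rewrite /= normr1. Qed.

Lemma absR_ge0 x : 0 <= absR x.
Proof. exact: normr_ge0. Qed.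

Lemma absR_gt0 x : x != 0 -> 0 < absR x.
Proof. by rewrite -normr_gt0. Qed.

Lemma absR_prod (I : finType) (P : pred I) (F : I -> algC) :
  absR (\prod_(i | P i) F i) = \prod_(i | P i) absR (F i).
Proof. exact: (big_morph absR absRM absR1). Qed.

Lemma absRX x n : absR (x ^+ n) = absR x ^+ n.
Proof. by elim: n => [|n IH]; rewrite ?absR1 // !exprS absRM IH. Qed.

Lemma absRV x : absR x^-1 = (absR x)^-1.
Proof.
have [->|x0] := eqVneq x 0.
  by apply: val_inj; rewrite invr0 (_ : absR 0 = 0) ?invr0 //; apply: val_inj; rewrite /= normr0.
by apply/esym/mulr1_eq; rewrite -absRM mulfV // absR1.
Qed.

Section WithUnit.
Variable u : algC.
Hypotheses (uU : is_cunit u) (u_real : u^* = u).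
Hypothesis u_lt1 : forall g, generic g -> `|sigma g u| < 1.

Let uO : u \in O. Proof. by case/and3P: uU. Qed.
Let u0 : u != 0. Proof. by case/and3P: uU. Qed.

(** The inverse makes the value at [k] equal to [sigma (k * g^-1) u], which is small unless [k] is
    [g] or [minus1 * g]. *)
Definition conj_unit (g : G) := sigma g^-1 u.

Lemma conj_unitU g : is_cunit (conj_unit g).
Proof. exact: is_cunit_sigma. Qed.

Definition ulog (g : G) : algR := absR (sigma g u) ^+ 2.

Lemma ulog_gt0 g : 0 < ulog g.
Proof. by rewrite exprn_gt0 // absR_gt0 // fmorph_eq0. Qed.

Lemma sigma_minus1_real g : sigma (minus1 * g)%g u = sigma g u.
Proof. by rewrite minus1C sigmaM // sigma_minus1 // u_real. Qed.

Lemma conj_unit_minus1 g : conj_unit (minus1 * g)%g = conj_unit g.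
Proof.
rewrite /conj_unit invMg (_ : minus1^-1 = minus1)%g -?minus1C ?sigma_minus1_real //.
by apply: (mulgI minus1); rewrite mulgV minus1_sqr.
Qed.

Lemma ulog_even g : ulog (minus1 * g)%g = ulog g.
Proof. by rewrite /ulog sigma_minus1_real. Qed.

Lemma ulog_lt1 g : g != 1%g -> g != minus1 -> ulog g < 1.
Proof.
move=> g1 gm; rewrite expr_lt1 //; last by rewrite ltW // absR_gt0 // fmorph_eq0.
by apply: u_lt1; apply/andP.
Qed.

Lemma prod_abs_sigma x : is_cunit x -> \prod_g absR (sigma g x) = 1.
Proof.
by move=> xU; rewrite -absR_prod; apply: val_inj; apply: (cunit_norm xU).
Qed.

Lemma ulog_prod : \prod_g ulog g = 1.
Proof. by rewrite prodrXl prod_abs_sigma // expr1n. Qed.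

Lemma absR_sigma_conj_unit k g : absR (sigma k (conj_unit g)) ^+ 2 = ulog (k * g^-1)%g.
Proof. by rewrite /ulog /conj_unit sigmaM. Qed.

Definition trace_norm x : algR := \sum_g absR (sigma g x) ^+ 2.

(** The sum is the trace of [x * x^*], fixed by all [sigma g] and nonnegative. *)
Lemma trace_norm_nat x : x \in O -> exists n : nat, trace_norm x = n%:R.
Proof.
move=> xO.
have E : algRval (trace_norm x) = \sum_g sigma g (x * x^* ).
  rewrite rmorph_sum; apply: eq_bigr => g _.
  by rewrite rmorphXn /= normCK (rmorphM (sigma g)) /= sigma_conj.
have xxO : x * x^* \in O by rewrite rpredM ?conj_zring.
have : algRval (trace_norm x) \in Num.int.
  rewrite E; apply: sigma_fixed_int.
    by apply: rpred_sum => g _; apply: sigma_zring.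
  move=> g; rewrite rmorph_sum /= [RHS](reindex_inj (mulgI g)) /=.
  by apply: eq_bigr => h _; rewrite sigmaM.
have : 0 <= trace_norm x by apply: sumr_ge0 => g _; rewrite exprn_ge0 // absR_ge0.
rewrite -[0 <= _]/(0 <= algRval _) => t0 tI.
have /natrP[n tn] : algRval (trace_norm x) \in Num.nat by rewrite natrEint tI.
by exists n; apply: val_inj; rewrite /= tn rmorph_nat.
Qed.

(** Strong induction on the natural number [trace_norm w]: a unit with a large conjugate is divided
    by the conjugates of [u] indexed by the set from [contraction_decrease]; the remaining units
    have bounded conjugates and form a finite set. *)
Lemma cunit_generation : exists F : seq algC, (forall f, f \in F -> is_cunit f) /\
  forall w, is_cunit w -> exists2 f, f \in F & exists c : G -> nat,
    w = f * \prod_g conj_unit g ^+ c g.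
Proof.
have [B BP] := @contraction_decrease algR G minus1 ulog minus1_sqr ulog_gt0 ulog_lt1 ulog_prod.
(* [B] bounds squares of absolute values, and [r ^+ 2 < B] implies [r <= B + 1]. *)
have [F FP] := zring_bounded_finite (algRval B + 1).
exists [seq f <- F | is_cunit f]; split=> [f|]; first by rewrite mem_filter => /andP[].
suff W n w : is_cunit w -> trace_norm w = n%:R ->
    exists2 f, f \in [seq f <- F | is_cunit f] & exists c : G -> nat,
    w = f * \prod_g conj_unit g ^+ c g.
  move=> w wU; have [|n wn] := @trace_norm_nat w; first by case/and3P: wU.
  exact: W wn.
elim/ltn_ind: n w => n IH w wU wn.
have /and3P[wO _ w0] := wU.
pose y (g : G) := absR (sigma g w) ^+ 2.
have [wB|wB] := pselect (exists g, B <= y g); last first.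
  exists w.
    rewrite mem_filter wU FP // => g.
    have yB : y g < B by rewrite ltNge; apply/negP => yB; apply: wB; exists g.
    have : absR (sigma g w) <= B + 1.
      by rewrite /y in yB; have := sqr_ge0 (absR (sigma g w) - 1); nra.
    exact.
  by exists (fun=> 0%N); rewrite big1 ?mulr1.
have [|||S yS] := BP y _ _ _ wB.
- by rewrite prodrXl prod_abs_sigma // expr1n.
- by move=> g; rewrite exprn_gt0 // absR_gt0 // fmorph_eq0.
- move=> g; rewrite /y sigmaM // sigma_minus1 ?sigma_zring //; congr (_ ^+ _).
  by apply: val_inj; rewrite /= norm_conjC.
pose v := \prod_(g in S) conj_unit g.
have vU : is_cunit v by apply: is_cunit_prod => g _; apply: conj_unitU.
have wvU : is_cunit (w / v) by rewrite is_cunitM ?is_cunitV.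
have [|n' wvn] := @trace_norm_nat (w / v); first by case/and3P: wvU.
have lt_n : (n' < n)%N.
  rewrite -(ltr_nat algR) -wvn -wn; apply: le_lt_trans yS.
  rewrite le_eqVlt; apply/orP; left; apply/eqP; apply: eq_bigr => g _.
  rewrite fmorph_div absRM exprMn; congr (_ * _).
  rewrite absRV rmorph_prod absR_prod -prodfV -prodrXl /contraction.
  by apply: eq_bigr => h _; rewrite -absR_sigma_conj_unit exprVn.
have [f fF [c wvE]] := IH _ lt_n _ wvU wvn.
exists f => //; exists (fun g => c g + (g \in S))%N.
have v0 : v != 0 by case/and3P: vU.
rewrite -[w](divfK v0) wvE -mulrA; congr (_ * _).
rewrite /v [X in _ * X]big_mkcond -big_split /=; apply: eq_bigr => g _.
by rewrite exprD; case: (g \in S).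
Qed.

(** The exponents [p - q], extended by 0 outside [H], are symmetrized under [minus1] to satisfy the
    evenness in [multiplicative_indep]. The result is constant and vanishes at 1, as [H] contains
    neither 1 nor [minus1]; on [H] it still equals [p - q], because [H] meets each conjugate pair at
    most once. *)
Lemma conj_unit_indep (H : {set G}) (p q : G -> nat) :
  (forall g, g \in H -> generic g) -> (forall g, g \in H -> (minus1 * g)%g \notin H) ->
  \prod_(g in H) conj_unit g ^+ p g = \prod_(g in H) conj_unit g ^+ q g ->
  {in H, p =1 q}.
Proof.
move=> Hgen Hhalf pq.
pose b0 g : int := if g \in H then (p g)%:Z - (q g)%:Z else 0.
pose b g := b0 g + b0 (minus1 * g)%g.
have b0P k : \prod_g ulog (k * g^-1)%g ^ b0 g = 1.
  have E (r : G -> nat) : \prod_(g in H) ulog (k * g^-1)%g ^+ r g =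
      absR (sigma k (\prod_(g in H) conj_unit g ^+ r g)) ^+ 2.
    rewrite rmorph_prod absR_prod -prodrXl; apply: eq_bigr => g _.
    by rewrite -absR_sigma_conj_unit rmorphXn absRX -!exprM mulnC.
  rewrite (bigID (mem H)) /= [X in _ * X]big1 ?mulr1 => [|g /negPf gH]; last first.
    by rewrite /b0 gH expr0z.
  under eq_bigr => g gH do rewrite /b0 gH expfzDr ?gt_eqF ?ulog_gt0 // -exprnN.
  rewrite big_split /= prodfV !E pq mulfV // expf_neq0 // gt_eqF // absR_gt0 //.
  rewrite fmorph_eq0; apply/prodf_neq0 => g _; rewrite expf_neq0 //.
  by case/and3P: (conj_unitU g).
have bP : forall g h, b g = b h.
  apply: (@multiplicative_indep algR G minus1 ulog minus1_sqr ulog_gt0 ulog_lt1 ulog_prod).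
    by move=> g; rewrite /b mulgA minus1_sqr mul1g addrC.
  move=> k; under eq_bigr => g _ do rewrite expfzDr ?gt_eqF ?ulog_gt0 //.
  rewrite big_split /= b0P mul1r (reindex_inj (mulgI minus1)) /= -[RHS](b0P k).
  apply: eq_bigr => g _; rewrite mulgA minus1_sqr mul1g -[RHS]/(ulog _ ^ _).
  congr (_ ^ _); rewrite -[RHS]ulog_even; congr ulog.
  rewrite invMg (_ : minus1^-1 = minus1)%g; last first.
    by apply: (mulgI minus1); rewrite mulgV minus1_sqr.
  by rewrite mulgA -minus1C.
move=> g gH; have := bP g 1%g.
have N1 : (1%g \in H) = false by apply/negP => /Hgen; rewrite /generic eqxx.
have Nm : (minus1 \in H) = false by apply/negP => /Hgen; rewrite /generic eqxx andbF.
rewrite /b /b0 gH (negPf (Hhalf _ gH)) mulg1 N1 Nm !addr0 => /eqP.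
by rewrite subr_eq0 => /eqP[].
Qed.

(** [f] vanishes at all generic conjugates, since [g] and [minus1 * g] give the same one. The others
    share a single value; it is 0 because the product of all conjugates is the norm, whose square is
    1. *)
Lemma functional_conj_unit (H : {set G}) (f : algC -> int) :
  (forall x y, is_cunit x -> is_cunit y -> f (x * y) = f x + f y) ->
  (forall g, generic g -> g \in H \/ (minus1 * g)%g \in H) ->
  (forall g, g \in H -> f (conj_unit g) = 0) ->
  forall c : G -> nat, f (\prod_g conj_unit g ^+ c g) = 0.
Proof.
move=> fM Hcov fH.
have f1 : f 1 = 0.
  by apply: (addrI (f 1)); rewrite -fM ?is_cunit1 // mulr1 addr0.
have f_prod (F : G -> algC) : (forall g, is_cunit (F g)) -> f (\prod_g F g) = \sum_g f (F g).
  move=> FU; suff [] : is_cunit (\prod_g F g) /\ f (\prod_g F g) = \sum_g f (F g) by [].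
  elim/big_rec2: _ => [|g x y _ [yU yE]]; first by split=> //; apply: is_cunit1.
  by split; [apply: is_cunitM | rewrite fM // yE].
have f_exp x n : is_cunit x -> f (x ^+ n) = f x *+ n.
  move=> xU; elim: n => [|n IH]; first by rewrite f1.
  by rewrite exprS fM ?IH ?mulrS // is_cunitX.
suff fu0 g : f (conj_unit g) = 0.
  move=> c; rewrite f_prod => [|g]; last by rewrite is_cunitX // conj_unitU.
  by rewrite big1 // => g _; rewrite f_exp ?conj_unitU // fu0 mul0rn.
have fgen h : generic h -> f (conj_unit h) = 0.
  by move=> /Hcov[/fH//|/fH]; rewrite conj_unit_minus1.
have fngen h : ~~ generic h -> f (conj_unit h) = f (conj_unit 1%g).
  rewrite negb_and !negbK => /orP[/eqP->//|/eqP->].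
  by rewrite -[minus1]mulg1 conj_unit_minus1.
have [gg|ng] := boolP (generic g); first exact: fgen.
rewrite fngen //.
have : \sum_h f (conj_unit h) = 0.
  rewrite -f_prod; last exact: conj_unitU.
  have -> : \prod_h conj_unit h = cnorm u.
    by rewrite /cnorm [RHS](reindex_inj invg_inj).
  have /intrP[n nE] := cnorm_int uO.
  have nU : is_cunit (cnorm u).
    by apply: is_cunit_prod => h _; apply: is_cunit_sigma.
  have n2 : cnorm u * cnorm u = 1.
    have := cunit_norm uU; rewrite nE -intr_norm -intrM => /eqP.
    rewrite -[1]/(1%:~R) eqr_int => /eqP n1.
    by rewrite -expr2 -(real_normK (num_real n)) n1 expr1n.
  have /eqP := fM _ _ nU nU; rewrite n2 f1 eq_sym -mulr2n mulrn_eq0 /= => /eqP//.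
rewrite (bigID generic) /= big1 ?add0r => [|h /fgen//].
under eq_bigr => h hn do rewrite fngen //.
rewrite sumr_const => /eqP; rewrite mulrn_eq0 => /orP[|/eqP//].
by rewrite eqn0Ngt => /negP[]; apply/card_gt0P; exists g; rewrite unfold_in.
Qed.

End WithUnit.

(* The alternative [d = 1] is the case [m = 2], where [minus1 = 1]. *)
Lemma half_set : exists H : {set G},
  [/\ forall g, g \in H -> generic g, forall g, g \in H -> (minus1 * g)%g \notin H,
      forall g, generic g -> g \in H \/ (minus1 * g)%g \in H
    & d = #|H|.+1.*2 \/ d = 1 /\ #|H| = 0]%N.
Proof.
(* The one of [g] and [minus1 * g] that is enumerated first. *)
pose H : {set G} := [set g | generic g & (enum_rank g < enum_rank (minus1 * g)%g)%N].
have mK g : (minus1 * (minus1 * g) = g)%g by rewrite mulgA minus1_sqr mul1g.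
have Hgen g : g \in H -> generic g by rewrite inE => /andP[].
have Hhalf g : g \in H -> (minus1 * g)%g \notin H.
  by rewrite !inE mK => /andP[_ lt_g]; rewrite negb_and -leqNgt (ltnW lt_g) orbT.
have [m1|m1] := eqVneq minus1 1%g.
  have m2 : m = 2.
    have : ((2 : 'Z_m) = 0).
      have := congr1 val m1; rewrite /= => E.
      by rewrite -[2]/(1 + 1) -{1}E addNr.
    move/(congr1 (@nat_of_ord _)); rewrite val_Zp_nat // => /eqP m2.
    by have /(dvdn_leq (ltn0Sn _)) := m2; case: (m) m_gt1 => [|[|[|]]].
  have d1 : d = 1 by rewrite m2.
  have gen0 (g : G) : generic g = false.
    suff -> : g = 1%g by rewrite /generic eqxx.
    have /card_le1_eqP E : (#|{: G}| <= 1)%N by rewrite card_unit_Zp d1.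
    by apply: E.
  have H0 : H = set0 by apply/setP => g; rewrite !inE gen0.
  exists H; split => //; first by move=> g; rewrite gen0.
  by right; rewrite H0 cards0.
have mg g : (minus1 * g)%g != g by apply: contra m1; rewrite -{2}[g]mul1g => /eqP/mulIg/eqP.
have Hcov g : generic g -> g \in H \/ (minus1 * g)%g \in H.
  move=> gg; rewrite !inE mK generic_minus1 gg /=.
  have [|lt_g|/val_inj/enum_rank_inj E] := ltngtP (enum_rank g) (enum_rank (minus1 * g)%g).
  - by left.
  - by right.
  - by have := mg g; rewrite -E eqxx.
exists H; split => //; left.
rewrite -card_unit_Zp -cardsT.
have -> : [set: G] = [set 1%g; minus1] :|: (H :|: [set (minus1 * g)%g | g in H]).
  apply/setP => g; rewrite 2!in_setU in_set2 in_setT; apply/esym.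
  have [gg|] := boolP (generic g); last by rewrite negb_and !negbK => ->.
  apply/orP; right; case: (Hcov g gg) => [->//|gH].
  by apply/orP; right; apply/imsetP; exists (minus1 * g)%g; rewrite ?mK.
have imH : #|[set (minus1 * g)%g | g in H]| = #|H| by apply: card_imset; apply: mulgI.
have dis1 : [disjoint H & [set (minus1 * g)%g | g in H]].
  apply/pred0P => g /=; apply/negP => /andP[gH /imsetP[h hH E]].
  by move: gH; rewrite E (negPf (Hhalf h hH)).
have dis2 : [disjoint [set 1%g; minus1] & H :|: [set (minus1 * g)%g | g in H]].
  apply/pred0P => g /=; apply/negP => /andP[]; rewrite in_set2 in_setU => g1 gH.
  suff : generic g by rewrite /generic; case/orP: g1 => ->; rewrite ?andbF.
  by case/orP: gH => [/Hgen//|/imsetP[h hH ->]]; rewrite generic_minus1 Hgen.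
rewrite cardsU (disjoint_setI0 dis2) cards0 subn0.
rewrite [#|H :|: _|]cardsU (disjoint_setI0 dis1) cards0 subn0 imH cards2 eq_sym m1.
by rewrite addnn doubleS.
Qed.

(* Otherwise there are a prime [p] and a root of unity in [Z[z]] of order
   [p ^ e.+1] with [e = logn p m].  As [m] is even, some [k] prime to [m * p] is
   1 modulo [m] but not modulo [p ^ e.+1]; raising roots of unity to the power
   [k] defines an automorphism that fixes [z] but moves that root. *)
Lemma zring_torsion x N : (2 %| m)%N -> x \in O -> (0 < N)%N -> x ^+ N = 1 -> x ^+ m = 1.
Proof.
move=> m_even xO N0 xN.
have m0 : (0 < m)%N by apply: ltnW.
have [n prim_x _] := prim_order_exists N0 xN.
have n0 := prim_order_gt0 prim_x.
suff /dvdnP[k ->] : (n %| m)%N by rewrite mulnC exprM (prim_expr_order prim_x) expr1n.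
apply/(dvdn_partP _ n0) => p; rewrite mem_primes => /and3P[p_pr _ _].
rewrite p_part pfactor_dvdn // leqNgt; apply/negP.
set e := logn p m => lt_e.
have pe_n : (p ^ e.+1 %| n)%N by rewrite pfactor_dvdn.
have prim_y := dvdn_prim_root prim_x pe_n; set y := x ^+ _ in prim_y.
have yO : y \in O by rewrite rpredX.
have [k [km kp pk]] : exists k, [/\ k = 1 %[mod m], coprime k p & ~~ (k == 1 %[mod p ^ e.+1])].
  (* If [p] divides [m], then [k = 1 + m] works, since [p ^ e.+1] does not divide [m]. Otherwise [p]
     is odd, [m] being even, and [k] is taken to be 2 modulo [p]. *)
  have [pm|pm] := boolP (p %| m)%N.
    exists (1 + m)%N; split; first by rewrite modnDr.
      by have /dvdnP[c ->] := pm; rewrite -coprime_modl addnC modnMDl coprime_modl coprime1n.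
    rewrite eqn_mod_dvd ?leq_addr // addKn pfactor_dvdn // -/e.
    by rewrite ltnn.
  have cmp : coprime m p by rewrite coprime_sym prime_coprime.
  have p2 : coprime 2 p.
    by rewrite prime_coprime // dvdn_prime2 //; apply: contra pm => /eqP<-.
  exists (chinese m p 1 2); split.
  - exact: chinese_modl.
  - by rewrite -coprime_modl chinese_modr // coprime_modl.
  - apply/negP => /eqP E.
    have : (chinese m p 1 2 == 1 %[mod p])%N.
      have pe : (p %| p ^ e.+1)%N by rewrite dvdn_exp.
      by rewrite -(modn_dvdm _ pe) E modn_dvdm.
    rewrite chinese_modr // eqn_mod_dvd // => /dvdn_leq/=.
    by move=> /(_ isT); rewrite leqNgt prime_gt1.
have kmp : coprime k (m * p)%N.
  by rewrite coprimeMr kp andbT -coprime_modl km coprime_modl coprime1n.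
have [f fP] := Qn_aut_exists kmp.
have fz : f z = idfun z.
  rewrite fP; last by rewrite exprM (prim_expr_order prim_z) expr1n.
  by rewrite -(prim_expr_mod prim_z) km prim_expr_mod ?expr1.
have := rmorph_zring_eq fz yO; rewrite /= fP; last first.
  have : (p ^ e.+1 %| m * p)%N by rewrite expnSr dvdn_mul // pfactor_dvdn.
  by case/dvdnP => c ->; rewrite mulnC exprM (prim_expr_order prim_y) expr1n.
rewrite -[RHS]expr1 => /eqP; rewrite (eq_prim_root_expr prim_y).
by rewrite (negPf pk).
Qed.

End CyclotomicRing.

(** * Transfer to a domain of characteristic zero *)

Lemma char_zero_intr_eq0 (A : idomainType) (k : int) : char_zero A -> (k%:~R == 0 :> A) = (k == 0).
Proof.
move=> /pcharf0P A0; case: k => k; first by rewrite -pmulrn A0.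
by rewrite NegzE mulrNz oppr_eq0 -pmulrn A0 oppr_eq0.
Qed.

(** [w] is a root of ['X^m - 1], hence of some ['Phi_c] with [c] dividing [m]. Then [w ^+ c = 1], so
    [m] divides [c] and [c = m]. *)
Lemma root_Cyclotomic (A : idomainType) m (w : A) : (1 < m)%N -> m.-primitive_root w ->
  (map_poly intr 'Phi_m).[w] = 0.
Proof.
move=> m_gt1 prim_w; have m0 : (0 < m)%N by apply: ltnW.
have map_Xn1 k : map_poly (intr : int -> A) ('X^k - 1) = 'X^k - 1.
  by rewrite rmorphB rmorph1 /= map_polyXn.
have : (map_poly intr (\prod_(c <- divisors m) 'Phi_c)).[w] = 0.
  by rewrite prod_Cyclotomic // map_Xn1 !hornerE (prim_expr_order prim_w) subrr.
rewrite rmorph_prod horner_prod => /eqP; rewrite prodf_seq_eq0 => /hasP[c].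
rewrite -dvdn_divisors // => c_m /= /eqP Pc.
have c0 : (0 < c)%N := dvdn_gt0 m0 c_m.
have : (map_poly intr (\prod_(e <- divisors c) 'Phi_e)).[w] = 0.
  rewrite rmorph_prod horner_prod; apply/eqP; rewrite prodf_seq_eq0; apply/hasP.
  by exists c; rewrite ?divisors_id //= Pc.
rewrite prod_Cyclotomic // map_Xn1 !hornerE => /eqP; rewrite subr_eq0.
rewrite -(prim_order_dvd prim_w) => m_c.
by have /eqP <- : (c == m)%N by rewrite eqn_dvd c_m m_c.
Qed.

Section Transfer.
Variables (A : idomainType) (m : nat) (z : algC) (w : A).
Hypotheses (A0 : char_zero A) (m_gt1 : (1 < m)%N).
Hypotheses (prim_z : m.-primitive_root z) (prim_w : m.-primitive_root w).

Local Notation evz p := (map_poly intr (p : {poly int})).[z].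
Local Notation evw p := (map_poly intr (p : {poly int})).[w].

(** The remainder of [p] modulo ['Phi_m] vanishes at [z], hence at all its conjugates, hence
    identically; so ['Phi_m] divides [p]. *)
Lemma root_transfer (p : {poly int}) : evz p = 0 -> evw p = 0.
Proof.
move=> pz; pose r := Pdiv.CommonRing.rmodp p 'Phi_m.
have sz_r : (size r <= totient m)%N.
  rewrite -ltnS -size_Cyclotomic; apply: Pdiv.CommonRing.ltn_rmodpN0.
  by rewrite monic_neq0 ?Cyclotomic_monic.
have pE := Pdiv.RingMonic.rdivp_eq (Cyclotomic_monic m) p.
have rz : evz r = 0.
  move: pz; rewrite {1}pE rmorphD rmorphM /= (Cintr_Cyclotomic prim_z) !hornerE.
  have /rootP-> : root (cyclotomic z m) z by rewrite root_cyclotomic.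
  by rewrite mulr0 add0r.
have r0 : map_poly (intr : int -> algC) r = 0.
  apply: (conjugate_roots m_gt1 prim_z).
    by apply: leq_trans sz_r; apply: size_poly.
  by move=> g; rewrite -(sigma_gen m_gt1 prim_z) -rmorph_zpoly rz rmorph0.
have {}r0 : r = 0.
  apply: (map_inj_poly (f := intr : int -> algC)); rewrite ?rmorph0 ?r0 ?map_poly0 //.
  exact: intr_inj.
by rewrite pE -/r r0 addr0 rmorphM hornerM root_Cyclotomic // mulr0.
Qed.

(** If [p] did not vanish at [z], the norm of its value would be a nonzero integer [n] equal to
    [p * q] at [z] for some [q]. By [root_transfer] the same holds at [w], giving [n = 0] in [A],
    against characteristic zero. *)
Lemma root_transfer_inv (p : {poly int}) : evw p = 0 -> evz p = 0.
Proof.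
move=> pw; apply/eqP/negPn/negP => pz.
have pO : evz p \in zring z by apply/zringP; exists p.
have [y /zringP[q ->]] := cnorm_cofactor m_gt1 prim_z pO.
have /intrP[n nE] := cnorm_int m_gt1 prim_z pO; rewrite nE => pq.
have : evw (n%:P - p * q) = 0.
  apply: root_transfer; rewrite rmorphB rmorphM /= map_polyC.
  rewrite hornerD hornerN hornerC hornerM -pq; exact: subrr.
rewrite rmorphB rmorphM /= map_polyC !hornerE pw mul0r subr0 => /eqP.
rewrite char_zero_intr_eq0 // => /eqP n0.
by move: pz; rewrite -(cnorm_eq0 m_gt1) nE n0 eqxx.
Qed.

Lemma eq_transfer (p q : {poly int}) : (evz p = evz q) <-> (evw p = evw q).
Proof.
split=> /eqP; rewrite -subr_eq0 -hornerN -hornerD -rmorphB => /eqP.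
  move=> /root_transfer; rewrite rmorphB hornerD hornerN => /eqP.
  by rewrite subr_eq0 => /eqP.
move=> /root_transfer_inv; rewrite rmorphB hornerD hornerN => /eqP.
by rewrite subr_eq0 => /eqP.
Qed.

End Transfer.

(** The conjugates of [u] in a half set and their inverses are written as integer polynomials in [z]
    and evaluated at [w]. Relations are stated with natural exponents so that they are polynomial
    identities, which [eq_transfer] carries back to [algC]. *)
Lemma independent_units (A : idomainType) m (w : A) : char_zero A -> (1 < m)%N ->
  m.-primitive_root w ->
  exists r (v : 'I_r -> A), [/\ (totient m = r.+1.*2 \/ totient m = 1 /\ r = 0)%N,
    forall i, v i \is a GRing.unit
    & forall p q : 'I_r -> nat, \prod_i v i ^+ p i = \prod_i v i ^+ q i -> p =1 q].
Proof.
move=> A0 m_gt1 prim_w.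
have [z prim_z] := C_prim_root_exists (ltnW m_gt1).
have [u [uO uVO u0 u_real u_lt1]] := minkowski_unit m_gt1 prim_z.
have uU : is_cunit z u by apply/and3P.
have [H [Hgen Hhalf _ cardH]] := half_set m_gt1.
have /choice[P PE] (g : {unit 'Z_m}) : exists p : {poly int},
    conj_unit m_gt1 u g = (map_poly intr p).[z].
  by apply/zringP; case/and3P: (conj_unitU m_gt1 prim_z uU g).
have /choice[P' P'E] (g : {unit 'Z_m}) : exists p : {poly int},
    (conj_unit m_gt1 u g)^-1 = (map_poly intr p).[z].
  by apply/zringP; case/and3P: (conj_unitU m_gt1 prim_z uU g).
pose v g : A := (map_poly intr (P g)).[w].
exists #|H|, (fun i => v (enum_val i)); split => // [i|p q].
  apply/unitrPr; exists (map_poly intr (P' (enum_val i))).[w].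
  have E1 : (map_poly intr (1 : {poly int})).[w] = 1 by rewrite rmorph1 hornerC.
  rewrite -[RHS]E1 -hornerM -rmorphM; apply/(eq_transfer A0 m_gt1 prim_z prim_w).
  rewrite rmorphM rmorph1 hornerM hornerC -PE -P'E mulfV //.
  by case/and3P: (conj_unitU m_gt1 prim_z uU (enum_val i)).
have E (r : 'I_#|H| -> nat) :
    (map_poly intr (\prod_(i < #|H|) P (enum_val i) ^+ r i)).[w] = \prod_i v (enum_val i) ^+ r i.
  by rewrite rmorph_prod horner_prod; apply: eq_bigr => i _; rewrite rmorphXn horner_exp.
rewrite -!E => /(eq_transfer A0 m_gt1 prim_z prim_w).
rewrite !rmorph_prod !horner_prod => pq.
have [H0|[g0 g0H]] := set_0Vmem H.
  by move=> i; have := enum_valP i; move: (enum_val i) => g; rewrite H0 inE.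
pose ext (r : 'I_#|H| -> nat) g := r (enum_rank_in g0H g).
have pq' : {in H, ext p =1 ext q}.
  apply: (conj_unit_indep prim_z uU u_real u_lt1 Hgen Hhalf).
  have EE (r : 'I_#|H| -> nat) :
      \prod_(g in H) conj_unit m_gt1 u g ^+ ext r g =
      \prod_(i < #|H|) (map_poly intr (P (enum_val i) ^+ r i)).[z].
    rewrite (big_enum_val (fun g => conj_unit m_gt1 u g ^+ ext r g)).
    apply: eq_bigr => i _.
    by rewrite rmorphXn horner_exp /= -PE /ext enum_valK_in.
  by rewrite !EE.
by move=> i; have := pq' _ (enum_valP i); rewrite /ext !enum_valK_in.
Qed.

(** * Structure and rank of unit groups *)

Lemma group_morph1 (G H : groupType) (f : G -> H) :
  {morph f : x y / (x * y)%g} -> f 1%g = 1%g.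
Proof. by move=> fM; apply: (mulgI (f 1%g)); rewrite -fM !mulg1. Qed.

Lemma group_morphX (G H : groupType) (f : G -> H) k :
  {morph f : x y / (x * y)%g} -> {morph f : x / (x ^+ k)%g}.
Proof.
by move=> fM x; elim: k => [|k IH]; rewrite ?group_morph1 // !expgS fM IH.
Qed.

Lemma group_morphV (G H : groupType) (f : G -> H) :
  {morph f : x y / (x * y)%g} -> {morph f : x / (x^-1)%g}.
Proof.
by move=> fM x; apply/esym/mulg1_eq; rewrite -fM mulgV group_morph1.
Qed.

Lemma finitely_generated_iso (G H : groupType) :
  isomorphic G H -> finitely_generated G -> finitely_generated H.
Proof.
case=> f fM [f' fK f'K] [s sP]; exists (map f s) => S [S1 SM SV] Ss x.
rewrite -(f'K x); apply: (sP (fun y => S (f y))) => [|y ys]; last exact/Ss/map_f.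
split; first by rewrite group_morph1.
  by move=> a b Sa Sb; rewrite fM; apply: SM.
by move=> a Sa; rewrite group_morphV //; apply: SV.
Qed.

Section Structure.
Variables (G : groupType) (abG : abelian_group G) (fgG : finitely_generated G).

Lemma abelian_structure : exists g (y : 'I_g -> zmod_of abG) (ts : seq (zmod_of abG)),
  [/\ forall v, exists2 t, t \in ts & exists b, v = t + lincomb y b,
      forall t, t \in ts <-> torsion t
    & free_mod_torsion y].
Proof.
have [n [x xP]] := finitely_generated_lincomb abG fgG.
have [g [y [ts [yP tsP y_free]]]] := span_torsion_free x.
exists g, y, ts; split => // [v|t].
  by have [a ->] := xP v; apply: yP.
split=> [/tsP//|tT]; have [a ta] := xP t; have [t' t'ts [b tb]] := yP a.
suff b0 : b = 0 by rewrite ta tb b0 lincomb0 addr0.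
apply: y_free; have -> : lincomb y b = t - t' by rewrite ta tb addrC addKr.
by apply: torsionD => //; apply/torsionN/tsP.
Qed.

(** [H] is a model of the torsion subgroup: cyclic in characteristic zero, [{unit F}] in positive
    characteristic. *)
Lemma structure_iso (H : groupType) (phi : H -> G) :
  {morph phi : x y / (x * y)%g} -> injective phi ->
  (forall x : G, (exists h, phi h = x) <-> exists2 k, (0 < k)%N & (x ^+ k = 1)%g) ->
  exists g, isomorphic G (H * free_abelian g)%type.
Proof.
move=> phiM phi_inj phiT.
have [g [y [ts [yP tsT y_free]]]] := abelian_structure.
exists g; apply: isomorphic_sym.
pose F (u : H * free_abelian g) : G := (phi u.1 * (lincomb y u.2 : zmod_of abG))%g.
have phi_torsion h : torsion (phi h : zmod_of abG) by apply/phiT; exists h.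
exists F => [[h b] [h' b']|].
  have -> : F ((h, b) * (h', b'))%g =
      ((phi h : zmod_of abG) + (phi h' : zmod_of abG)) + (lincomb y b + lincomb y b').
    by rewrite -lincombD /F /= phiM.
  by rewrite addrACA.
apply: bijective_of_inj_surj => [[h b] [h' b'] E|v].
  have {}E : (phi h : zmod_of abG) + lincomb y b = (phi h' : zmod_of abG) + lincomb y b' := E.
  have /eqP bb' : (b : 'rV[int]_g) - b' = 0.
    apply: y_free; rewrite lincombB.
    have -> : lincomb y b - lincomb y b' = (phi h' : zmod_of abG) - (phi h : zmod_of abG).
      apply/eqP; rewrite subr_eq addrAC eq_sym subr_eq addrC eq_sym; apply/eqP.
      by rewrite [LHS]addrC E addrC.
    by apply: torsionD => //; apply: torsionN.
  move: bb'; rewrite subr_eq0 => /eqP bb'; rewrite bb' in E *.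
  by move/addIr/phi_inj: E => ->.
have [t /tsT/phiT[h ht] [b ->]] := yP v.
by exists (h, b); rewrite /F /= ht.
Qed.

End Structure.

(* If [r < g], some nonzero integral linear form on [Z^g] vanishes on the [E i],
   but its values are unbounded. *)
Lemma rank_le_of_functionals (G : groupType) g r (pi : G -> 'rV[int]_g)
    (E : 'I_r -> G) (F : seq G) :
  (forall x y, pi (x * y)%g = pi x + pi y) -> (forall b, exists x, pi x = b) ->
  (forall f : G -> int, (forall x y, f (x * y)%g = f x + f y) ->
     (forall i, f (E i) = 0) -> forall w, f w \in map f F) ->
  (g <= r)%N.
Proof.
move=> piM pi_surj funP; rewrite leqNgt; apply/negP => rg.
pose W : 'M[int]_(r, g) := \matrix_i pi (E i).
have [a a0 aW] := int_row_kernel W^T rg.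
pose f x : int := (a *m (pi x)^T) 0 0.
have fM x y : f (x * y)%g = f x + f y by rewrite /f piM raddfD /= mulmxDr mxE.
have fE i : f (E i) = 0.
  have /matrixP/(_ 0 i) := aW; rewrite !mxE => <-.
  by rewrite /f mxE; apply: eq_bigr => j _; rewrite !mxE.
pose n : int := (a *m a^T) 0 0.
have n0 : 0 < n.
  have nE : n = \sum_j a 0 j ^+ 2.
    by rewrite /n mxE; apply: eq_bigr => j _; rewrite mxE expr2.
  rewrite lt_neqAle nE sumr_ge0 ?andbT; last by move=> j _; apply: sqr_ge0.
  rewrite eq_sym; apply: contra a0; rewrite psumr_eq0 => [/allP aj|j _]; last exact: sqr_ge0.
  apply/eqP/rowP => j; rewrite mxE; apply/eqP.
  by have := aj j (mem_index_enum _); rewrite sqrf_eq0.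
(* [f] takes the value [k * n >= k] at any element above [k *: a], and [k] exceeds all values of [f]
   on [F]. *)
pose k : int := 1 + \sum_(x <- F) `|f x|.
have S0 : 0 <= \sum_(x <- F) `|f x| by apply: sumr_ge0.
have k0 : 0 < k by rewrite ltr_pwDl.
have [w wE] := pi_surj (k *: a).
have fw : f w = k * n by rewrite /f wE linearZ /= -scalemxAr mxE.
have /mapP[x xF fx] := funP f fM fE w.
have : `|f x| <= \sum_(x <- F) `|f x|.
  rewrite (perm_big _ (perm_to_rem xF)) big_cons lerDl.
  by apply: sumr_ge0.
rewrite -fx fw (gtr0_norm (mulr_gt0 k0 n0)) => kn.
have /le_trans/(_ kn) : k <= k * n by rewrite ler_pMr // -gtz0_ge1.
by rewrite /k gerDr.
Qed.

(** More than [g] elements have linearly dependent images in [Z^g]. The corresponding combination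
    lies in the kernel of [pi], and [N] times it is a relation among the [v i]. *)
Lemma independent_rank_le (G : groupType) (abG : abelian_group G) N g r
    (pi : G -> 'rV[int]_g) (v : 'I_r -> zmod_of abG) :
  (forall x y, pi (x * y)%g = pi x + pi y) ->
  (forall x, pi x = 0 -> (x ^+ N = 1)%g) -> (0 < N)%N ->
  (forall a, lincomb v a = 0 -> a = 0) -> (r <= g)%N.
Proof.
move=> piM piK N0 v_indep; rewrite leqNgt; apply/negP => gr.
pose W : 'M[int]_(r, g) := \matrix_i pi (v i).
have [a /eqP a0 aW] := int_row_kernel W gr; apply: a0.
pose pi' : zmod_of abG -> 'rV[int]_g := pi.
have pi'D : {morph pi' : x y / x + y} by exact: piM.
have pi'0 : pi' 0 = 0 by apply: (addrI (pi' 0)); rewrite -pi'D !addr0.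
have pi'N x : pi' (- x) = - pi' x by apply: (addrI (pi' x)); rewrite -pi'D !subrr.
have pi'Mn x k : pi' (x *+ k) = pi' x *+ k by elim: k => // k IH; rewrite !mulrS pi'D IH.
have pi'Mz x (k : int) : pi' (x *~ k) = pi' x *~ k.
  by case: k => k; rewrite ?NegzE ?mulrNz ?pi'N -?pmulrn pi'Mn.
have pia : pi' (lincomb v a) = 0.
  rewrite -[RHS]aW (big_morph _ pi'D pi'0) mulmx_sum_row; apply: eq_bigr => i _.
  by rewrite pi'Mz rowK -scaler_int intz.
have /v_indep : lincomb v (a *+ N) = 0 by rewrite lincombMn; apply: piK.
move=> /rowP aN; apply/rowP => i; have := aN i; rewrite mulmxnE !mxE => /eqP.
by rewrite mulrn_eq0 eqn0Ngt N0 => /eqP.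
Qed.

Lemma units_abelian (A : idomainType) : abelian_group (units A).
Proof. by move=> x y; apply/val_inj/mulrC. Qed.

Lemma val_unitsX (A : idomainType) (x : units A) k : val (x ^+ k)%g = val x ^+ k.
Proof. by elim: k => // k IH; rewrite expgS exprS -IH. Qed.

Definition is_root_of_unity (A : idomainType) (x : A) := exists2 k, (0 < k)%N & x ^+ k = 1.

Lemma root_of_unity_unit (A : idomainType) (x : A) : is_root_of_unity x -> x \is a GRing.unit.
Proof. by case=> -[//|k] _ xk; apply/unitrPr; exists (x ^+ k); rewrite -exprS. Qed.

Lemma torsion_units (A : idomainType) (x : units A) :
  (exists2 k, (0 < k)%N & (x ^+ k = 1)%g) <-> is_root_of_unity (val x).
Proof.
split=> -[k k0 xk]; exists k => //; first by rewrite -val_unitsX xk.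
by apply: val_inj; rewrite val_unitsX xk.
Qed.

Lemma roots_of_unity_finite (A : idomainType) : finitely_generated (units A) ->
  exists2 s : seq A, uniq s & forall x, x \in s <-> is_root_of_unity x.
Proof.
move=> fgA.
have [g [y [ts [_ tsT _]]]] := abelian_structure (@units_abelian A) fgA.
exists (undup [seq val (t : units A) | t <- ts]); first exact: undup_uniq.
move=> x; rewrite mem_undup; split=> [/mapP[t /tsT tT ->]|xT].
  by apply/torsion_units.
apply/mapP; exists (MkUnits (root_of_unity_unit xT)) => //.
by apply/tsT/torsion_units.
Qed.

(* Every root of unity has order dividing [size s]: multiplication by it permutes
   [s], hence multiplies the product of [s] by 1. *)
Lemma primitive_root_of_finite (A : idomainType) (s : seq A) : uniq s ->
  (forall x, x \in s <-> is_root_of_unity x) ->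
  exists2 w : A, (size s).-primitive_root w & forall x, x \in s <-> exists i, x = w ^+ i.
Proof.
move=> s_uniq sT.
have s1 : 1 \in s by apply/sT; exists 1%N.
have s0 : (0 < size s)%N by case: (s) s1.
have sM x y : x \in s -> y \in s -> x * y \in s.
  move=> /sT[k k0 xk] /sT[l l0 yl]; apply/sT; exists (k * l)%N; first by rewrite muln_gt0 k0.
  by rewrite exprMn exprM xk expr1n mulnC exprM yl expr1n mulr1.
have sN0 x : x \in s -> x != 0.
  by move=> /sT/root_of_unity_unit xU; apply: contraTneq xU => ->; rewrite unitr0.
have sX x : x \in s -> x ^+ size s = 1.
  move=> xs; have P0 : \prod_(t <- s) t != 0.
    by rewrite prodf_seq_neq0; apply/allP => t ts; apply: sN0.
  have map_uniq : uniq (map ( *%R x) s) by rewrite map_inj_uniq //; apply/mulfI/sN0.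
  have map_sub : {subset map ( *%R x) s <= s} by move=> _ /mapP[t ts ->]; apply: sM.
  have [_ map_eq] := uniq_min_size map_uniq map_sub (eq_leq (esym (size_map _ _))).
  apply: (mulIf P0); rewrite mul1r -[RHS](perm_big _ (uniq_perm map_uniq s_uniq map_eq)) /=.
  by rewrite big_map big_split /= big_const_seq count_predT -Monoid.iteropE.
(* The primitive root is found in the fraction field, where [has_prim_root] applies; it lies in the
   image of [s]. *)
pose rs := map (@tofrac A) s.
have tofrac_inj : injective (@tofrac A) by move=> x y /eqP; rewrite tofrac_eq => /eqP.
have /hasP[_ /mapP[w ws ->] prim_w] : has (size s).-primitive_root rs.
  apply: has_prim_root => //.
  - by apply/allP => _ /mapP[x xs ->]; rewrite unity_rootE -tofracXn sX ?tofrac1.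
  - by rewrite map_inj_uniq.
  - by rewrite size_map.
have prim_w' : (size s).-primitive_root w.
  apply/andP; split => //; apply/forallP => i.
  have /andP[_ /forallP/(_ i)] := prim_w.
  by rewrite !unity_rootE -tofracXn -tofrac1 tofrac_eq.
exists w => // x; split=> [/sX xs|[i ->]].
  have [|i xi] := prim_rootP prim_w (x := tofrac x); first by rewrite -tofracXn xs tofrac1.
  by exists i; apply: tofrac_inj; rewrite xi tofracXn.
by apply/sT; exists (size s); rewrite // exprAC sX ?expr1n.
Qed.

Lemma cyclic_structure (G : groupType) (abG : abelian_group G) (fgG : finitely_generated G)
    N (w : G) : (1 < N)%N -> (forall i j, (w ^+ i == w ^+ j)%g = (i == j %[mod N])) ->
  (forall x : G, (exists i, x = w ^+ i)%g <-> exists2 k, (0 < k)%N & (x ^+ k = 1)%g) ->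
  exists g, isomorphic G (cyclic_group N * free_abelian g)%type.
Proof.
move=> N1 wE wT; pose phi (i : cyclic_group N) : G := (w ^+ (i : 'Z_N))%g.
have ZN : (Zp_trunc N).+2 = N := Zp_cast N1.
have lt_N (i : 'Z_N) : (i < N)%N by rewrite -[X in (_ < X)%N]ZN; apply: ltn_ord.
apply: (@structure_iso G abG fgG _ phi).
- move=> i j; apply/eqP; rewrite -expgnDr wE.
  by rewrite -[X in (_ %% X == _ %% X)%N]ZN modn_mod.
- move=> i j /eqP; rewrite wE !modn_small //; exact: val_eqP.
- move=> x; rewrite -wT; split=> [[h <-]|[i ->]]; first by exists (h : 'Z_N).
  exists (i%:R : 'Z_N); apply/eqP; rewrite /phi wE val_Zp_nat //.
  by rewrite modn_mod.
Qed.

Lemma cyclic_group_exponent N (c : cyclic_group N) : (1 < N)%N -> (c ^+ N = 1)%g.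
Proof.
move=> N1; have E : (c : 'Z_N) *+ N = 0.
  rewrite -mulr_natr (_ : N%:R = 0) ?mulr0 //.
  by apply: val_inj; rewrite /= val_Zp_nat // modnn.
exact: E.
Qed.

Lemma units_char_zero (A : idomainType) : char_zero A -> finitely_generated (units A) ->
  exists n g, [/\ (1 <= n)%N, (totient (2 * n))%:R / 2 - 1 <= g%:R :> rat
    & isomorphic (units A) (cyclic_group (2 * n) * free_abelian g)%type].
Proof.
move=> A0 fgA.
have [s s_uniq sT] := roots_of_unity_finite fgA.
have [w prim_w wP] := primitive_root_of_finite s_uniq sT.
set N := size s in prim_w.
have two0 : (2 : A) != 0 by have /pcharf0P := A0 => ->.
have N1N : (-1 : A) != 1 by rewrite eq_sym -subr_eq0 opprK.
have sN1 : -1 \in s by apply/sT; exists 2; rewrite ?sqrrN ?expr1n.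
have N_even : ~~ odd N.
  apply: contra N1N => N_odd; apply/eqP.
  have [i wi] : exists i, -1 = w ^+ i by apply/wP.
  have : (-1) ^+ N = 1 :> A by rewrite wi exprAC (prim_expr_order prim_w) expr1n.
  by rewrite -signr_odd N_odd expr1.
have N0 : (0 < N)%N := prim_order_gt0 prim_w.
have [n Nn] : exists n, N = (2 * n)%N.
  by exists N./2; rewrite mul2n -[LHS]odd_double_half (negPf N_even).
have n0 : (0 < n)%N by move: N0; rewrite Nn muln_gt0.
have N1 : (1 < N)%N by rewrite Nn -[1%N]/(2 * 1).-1 prednK ?leq_mul // .
have wU : w \is a GRing.unit.
  by apply: root_of_unity_unit; exists N; rewrite ?(prim_expr_order prim_w).
have [||g isoA] := @cyclic_structure _ (@units_abelian A) fgA N (MkUnits wU) N1.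
- by move=> i j; rewrite -(eq_prim_root_expr prim_w) -(inj_eq val_inj) !val_unitsX.
- move=> x; rewrite torsion_units -sT wP; split=> -[i xi]; exists i.
    by rewrite xi val_unitsX.
  by apply: val_inj; rewrite val_unitsX.
exists n, g; rewrite -Nn; split => //.
have [r [v [rN vU v_indep]]] := independent_units A0 N1 prim_w.
suff rg : (r <= g)%N.
  (* If [totient N = r.+1.*2], the required bound is exactly [r <= g]; if [totient N = 1], its left
     side is negative. *)
  have {}rg : r%:R <= g%:R :> rat by rewrite ler_nat.
  case: rN => [->|[-> _]]; last by have g0 := ler0n rat g; lra.
  by rewrite -mul2n -[r.+1]addn1 natrM natrD; lra.
case: isoA => f fM [f' fK f'K].
pose pi x : 'rV[int]_g := (f x).2.
apply: (@independent_rank_le _ (@units_abelian A) N g r pi (fun i => MkUnits (vU i))) => //.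
- by move=> x y; rewrite /pi fM.
- move=> x px; apply: (can_inj fK); rewrite (group_morphX N fM) (group_morph1 fM).
  move: px; rewrite /pi; case: (f x) => c b /= ->.
  pose c' : (cyclic_group N * free_abelian g)%type := (c, 0 : 'rV[int]_g).
  have cX k : (c' ^+ k = (c ^+ k, (0 : 'rV[int]_g) : free_abelian g))%g.
    elim: k => // k IH; rewrite !expgS IH; congr (_, _); exact: addr0.
  by rewrite -/c' cX cyclic_group_exponent.
- move=> a va.
  have val_lincomb : \prod_i v i ^ a 0 i = 1.
    pose val' : zmod_of (@units_abelian A) -> A := val.
    have val'z (x : zmod_of (@units_abelian A)) (k : int) : val' (x *~ k) = val' x ^ k.
      have val'X l : val' (x *+ l) = val' x ^+ l by apply: val_unitsX.
      have val'V y : val' (- y) = (val' y)^-1.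
        by apply/esym/mulr1_eq; apply: (congr1 val (@mulgV (units A) y)).
      case: k => k; first exact: val'X.
      by rewrite NegzE mulrNz val'V -exprnN -val'X.
    apply: etrans (congr1 val' va).
    rewrite /lincomb (big_morph val' (id1 := 1) (op1 := *%R)) //.
    by apply: eq_bigr => i _; rewrite val'z.
  (* The integer exponents are split into positive and negative parts, as independence of the [v i]
     is stated for natural exponents. *)
  pose p i := absz (Num.max (a 0 i) 0); pose q i := absz (Num.max (- a 0 i) 0).
  have pqE i : v i ^+ p i = v i ^ a 0 i * v i ^+ q i.
    rewrite /p /q; case: (a 0 i) => k.
      by rewrite max_l // (max_r (_ : - Posz k <= 0)) ?oppr_le0 // mulr1.
    rewrite max_r // max_l // NegzE opprK -exprnN mulVr ?unitrX //.
  have /v_indep pq : \prod_i v i ^+ p i = \prod_i v i ^+ q i.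
    transitivity ((\prod_i v i ^ a 0 i) * \prod_i v i ^+ q i); last by rewrite val_lincomb mul1r.
    rewrite -big_split /=.
    by apply: eq_bigr => i _; rewrite pqE.
  apply/rowP => i; rewrite mxE; have := pq i; rewrite /p /q.
  case: (a 0 i) => k.
    by rewrite max_l // (max_r (_ : - Posz k <= 0)) ?oppr_le0 // => /= ->.
  by rewrite max_r // max_l.
Qed.

Lemma free_abelian_add (H : groupType) g k :
  isomorphic (H * free_abelian (g + k))%type (H * free_abelian g * free_abelian k)%type.
Proof.
exists (fun x => ((x.1, lsubmx (x.2 : 'rV[int]_(g + k))), rsubmx (x.2 : 'rV[int]_(g + k)))).
  move=> [h v] [h' v']; congr (_, _, _); [exact: (linearD lsubmx) | exact: (linearD rsubmx)].
exists (fun x => (x.1.1, row_mx x.1.2 x.2 : 'rV[int]_(g + k))).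
  by move=> [h v]; rewrite /= hsubmxK.
by move=> [[h v] w]; rewrite /= row_mxKl row_mxKr.
Qed.

(** * The unit group of the cyclotomic ring and its rank *)

Section CyclotomicUnits.
Variables (m : nat) (z : algC).
Hypotheses (m_gt1 : (1 < m)%N) (prim_z : m.-primitive_root z) (m_even : (2 %| m)%N).

Definition cyclotomic_domain : idomainType := subdomain (zring z).
Local Notation U := (units cyclotomic_domain).

Definition cunit_val (x : U) : algC := val (val x).

Lemma cunit_val_inj : injective cunit_val.
Proof. by move=> x y /val_inj/val_inj. Qed.

Lemma cunit_valM x y : cunit_val (x * y)%g = cunit_val x * cunit_val y.
Proof. by []. Qed.

Lemma cunit_valX x k : cunit_val (x ^+ k)%g = cunit_val x ^+ k.
Proof. by elim: k => // k IH; rewrite expgS exprS -IH. Qed.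

Lemma cunit_valP x : is_cunit z (cunit_val x).
Proof.
have /andP[x0 xV] := valP x.
by apply/and3P; split => //; apply: valP (val x).
Qed.

Lemma cunit_val_surj x : is_cunit z x -> exists y, cunit_val y = x.
Proof.
move=> /and3P[xO xVO x0].
pose x1 : cyclotomic_domain := exist _ x xO.
have x1U : x1 \is a GRing.unit by apply/andP.
by exists (MkUnits x1U).
Qed.

(** Made total, with value 1 outside the units, so that a functional on [U] becomes a function on
    [algC] as in [functional_conj_unit]. *)
Definition to_cunit (x : algC) : U :=
  if pselect (exists y, cunit_val y = x) is left h then projT1 (cid h) else 1%g.

Lemma to_cunitK x : is_cunit z x -> cunit_val (to_cunit x) = x.
Proof.
move=> /cunit_val_surj h; rewrite /to_cunit; case: pselect => // h'.
by case: (cid h').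
Qed.

Lemma cunit_valK x : to_cunit (cunit_val x) = x.
Proof. by apply: cunit_val_inj; rewrite to_cunitK ?cunit_valP. Qed.

Lemma to_cunitM x y : is_cunit z x -> is_cunit z y ->
  to_cunit (x * y) = (to_cunit x * to_cunit y)%g.
Proof.
by move=> xU yU; apply: cunit_val_inj; rewrite cunit_valM !to_cunitK // is_cunitM.
Qed.

Lemma parametrizes_cunit : parametrizes_units (zring z) cunit_val.
Proof.
split; [by []|exact: cunit_val_inj|by move=> h; case/and3P: (cunit_valP h)|].
by move=> x x0 xO xVO; apply: cunit_val_surj; apply/and3P.
Qed.

(** A functional on [U] that vanishes at the conjugates indexed by [H] takes only the values it has
    on the finite set [F], so [rank_le_of_functionals] applies. The upper bound on [g] suffices, as
    missing rank is supplied by Laurent variables. *)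
Lemma cyclotomic_units : exists r g, [/\ (totient m = r.+1.*2 \/ totient m = 1 /\ r = 0)%N,
  (g <= r)%N & isomorphic U (cyclic_group m * free_abelian g)%type].
Proof.
have [u [uO uVO u0 u_real u_lt1]] := minkowski_unit m_gt1 prim_z.
have uU : is_cunit z u by apply/and3P.
have [H [Hgen Hhalf Hcov cardH]] := half_set m_gt1.
have [F [FU FP]] := cunit_generation prim_z uU u_lt1.
have uU' g : is_cunit z (conj_unit m_gt1 u g) := conj_unitU m_gt1 prim_z uU g.
have prodU c : is_cunit z (\prod_g conj_unit m_gt1 u g ^+ c g).
  by apply: is_cunit_prod => g _; apply: is_cunitX.
have fgU : finitely_generated U.
  exists (map to_cunit F ++ [seq to_cunit (conj_unit m_gt1 u g) | g <- enum {: {unit 'Z_m}}]).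
  move=> S [S1 SM _] Ss x.
  have [f fF [c xE]] := FP _ (cunit_valP x).
  rewrite -[x]cunit_valK xE (to_cunitM (FU _ fF) (prodU c)); apply: (SM).
    by apply: Ss; rewrite mem_cat map_f.
  suff [] : is_cunit z (\prod_g conj_unit m_gt1 u g ^+ c g) /\
            S (to_cunit (\prod_g conj_unit m_gt1 u g ^+ c g)) by [].
  have c1 : is_cunit z 1 /\ S (to_cunit 1).
    split; first exact: is_cunit1.
    by rewrite (_ : to_cunit 1 = 1%g) //; apply: (cunit_valK 1%g).
  have cM a b : is_cunit z a /\ S (to_cunit a) -> is_cunit z b /\ S (to_cunit b) ->
      is_cunit z (a * b) /\ S (to_cunit (a * b)).
    move=> [aU aS] [bU bS]; split; first exact: is_cunitM.
    by rewrite to_cunitM //; apply: (SM).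
  apply: (big_ind (fun a => is_cunit z a /\ S (to_cunit a))) => // g _.
  elim: (c g) => [|k IH] //; rewrite exprS; apply: cM => //; split => //.
  apply: Ss; rewrite mem_cat; apply/orP; right; apply: map_f; exact: mem_enum.
have zO : z \in zring z := zring_gen z.
have zX : z ^+ m = 1 := prim_expr_order prim_z.
have zU : is_cunit z z.
  have z0 : z != 0 by rewrite -normr_eq0 (norm_gen m_gt1 prim_z) oner_eq0.
  apply/and3P; split => //; rewrite (_ : z^-1 = z ^+ m.-1) ?rpredX //.
  by apply: mulr1_eq; rewrite -exprS prednK // ltnW.
have [||g isoU] := @cyclic_structure U (@units_abelian _) fgU m (to_cunit z) m_gt1.
- move=> i j; rewrite -(eq_prim_root_expr prim_z) -(inj_eq cunit_val_inj).
  by rewrite !cunit_valX to_cunitK.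
- move=> x; split=> [[i ->]|[k k0 xk]].
    exists m; first exact: ltnW.
    by apply: cunit_val_inj; rewrite !cunit_valX to_cunitK // exprAC zX expr1n.
  have xm : cunit_val x ^+ m = 1.
    apply: (zring_torsion m_gt1 prim_z m_even _ k0); first by case/and3P: (cunit_valP x).
    by rewrite -cunit_valX xk.
  have [i xi] := prim_rootP prim_z xm; exists (nat_of_ord i).
  by apply: cunit_val_inj; rewrite cunit_valX to_cunitK.
exists #|H|, g; split => //.
case: (isoU) => f fM [f' fK f'K].
pose pi x : 'rV[int]_g := (f x).2.
apply: (@rank_le_of_functionals U g #|H| pi
  (fun i => to_cunit (conj_unit m_gt1 u (enum_val i))) (map to_cunit F)).
- by move=> x y; rewrite /pi fM.
- by move=> b; exists (f' (1%g, b)); rewrite /pi f'K.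
- move=> h hM hE w; have [a aF [c wE]] := FP _ (cunit_valP w).
  apply/mapP; exists (to_cunit a); first exact: map_f.
  rewrite -[w]cunit_valK wE (to_cunitM (FU _ aF) (prodU c)) hM.
  have -> : h (to_cunit (\prod_g conj_unit m_gt1 u g ^+ c g)) = 0; last by rewrite addr0.
  apply: (functional_conj_unit prim_z uU u_real (f := h \o to_cunit) _ Hcov).
    by move=> x y xU yU; rewrite /= to_cunitM // hM.
  move=> k kH; have := hE (enum_rank_in kH k).
  by rewrite enum_rankK_in.
Qed.

End CyclotomicUnits.

Lemma char_zero_realization n g : (1 <= n)%N ->
  (totient (2 * n))%:R / 2 - 1 <= g%:R :> rat ->
  exists A : idomainType, char_zero A /\
    isomorphic (cyclic_group (2 * n) * free_abelian g)%type (units A).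
Proof.
move=> n0 gE; have m1 : (1 < 2 * n)%N.
  by rewrite mul2n -addnn; case: (n) n0 => [|k] // _; rewrite addnS.
have [z prim_z] := C_prim_root_exists (ltnW m1).
have [r [g0 [rE g0r isoU]]] := cyclotomic_units m1 prim_z (dvdn_mulr n (dvdnn 2)).
have rg : (r <= g)%N.
  case: rE => [rE|[_ ->//]]; rewrite -(ler_nat rat).
  by move: gE; rewrite rE -mul2n -[r.+1]addn1 natrM natrD; lra.
have g0g : (g0 <= g)%N := leq_trans g0r rg.
have [A [charA isoA]] := units_laurent_domain (g - g0) (parametrizes_cunit z).
exists A; split; first by move=> p; rewrite charA (pchar_num algC).
apply: isomorphic_trans isoA.
rewrite -{1}(subnKC g0g); apply: isomorphic_trans (free_abelian_add _ _ _) _.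
apply: isomorphic_prod; first exact: isomorphic_sym.
by exists id => //; exists id.
Qed.

(** * Positive characteristic *)

(** The two proofs are parameters of the type so that the ring and field instances can use them. *)
Definition finite_subring (A : idomainType) (s : seq A)
  of subring_closed [pred x in s] & (forall x, x \in s -> x != 0 -> is_root_of_unity x) : Type :=
  seq_sub s.

Section FiniteSubring.
Variables (A : idomainType) (s : seq A).
Hypotheses (sR : subring_closed [pred x in s])
  (sT : forall x, x \in s -> x != 0 -> is_root_of_unity x).

Local Notation F := (finite_subring sR sT).

HB.instance Definition _ := SubType.copy F (seq_sub s).
HB.instance Definition _ := Finite.copy F (seq_sub s).
HB.instance Definition _ := GRing.SubChoice_isSubComNzRing.Build A (mem s) F sR.

Lemma finite_subring_inv_subproof (x : F) : x != 0 -> {y : F | y * x = 1}.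
Proof.
move=> x0; apply: sig_eqW.
have [|[|k] // _ xk] := @sT (val x) (valP x).
  by rewrite -(inj_eq val_inj) in x0.
exists (x ^+ k); apply: val_inj; rewrite -exprSr.
by rewrite rmorphXn rmorph1.
Qed.

Definition finite_subring_inv (x : F) : F :=
  if eqVneq x 0 is NeqNotEq h then sval (finite_subring_inv_subproof h) else 0.

Fact finite_subring_mulVf x : x != 0 -> finite_subring_inv x * x = 1.
Proof.
by rewrite /finite_subring_inv; case: eqVneq => // h _; case: (finite_subring_inv_subproof h).
Qed.

Fact finite_subring_inv0 : finite_subring_inv 0 = 0.
Proof. by rewrite /finite_subring_inv; case: eqVneq => // h; case/eqP: (h). Qed.

HB.instance Definition _ := GRing.ComNzRing_isField.Build F
  finite_subring_mulVf finite_subring_inv0.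

End FiniteSubring.

Lemma roots_of_unity_field (A : idomainType) p (s : seq A) : p \in [pchar A] ->
  uniq s -> (forall x, x \in s <-> is_root_of_unity x) -> subring_closed [pred x in 0 :: s].
Proof.
move=> pA s_uniq sT.
have [w prim_w wP] := primitive_root_of_finite s_uniq sT.
set N := size s in prim_w.
have p_pr := pcharf_prime pA.
have N0 : (0 < N)%N := prim_order_gt0 prim_w.
have coNp : coprime p N.
  rewrite prime_coprime //; apply/negP => pN.
  (* If [p] divided [N], Frobenius would give [w ^+ (N %/ p)] equal to 1, against the order of
     [w]. *)
  have /eqP : (w ^+ (N %/ p) - 1) ^+ p = 0.
    rewrite -(pFrobenius_autE pA) rmorphB rmorph1 /= pFrobenius_autE -exprM divnK //.
    by rewrite (prim_expr_order prim_w) subrr.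
  rewrite expf_eq0 prime_gt0 //= subr_eq0 -(prim_order_dvd prim_w).
  move/dvdn_leq; rewrite divn_gt0 ?prime_gt0 // dvdn_leq // => /(_ isT).
  by rewrite leqNgt ltn_Pdiv ?prime_gt1.
(* By Euler's theorem [q] is 1 modulo [N], so the [q]-th power fixes every root of unity; it is
   additive as a power of Frobenius. *)
pose q := (p ^ totient N)%N.
have q1 : (1 < q)%N by rewrite -(exp1n (totient N)) ltn_exp2r ?totient_gt0 ?prime_gt1.
have inE0 x : x \in 0 :: s <-> x ^+ q = x.
  rewrite in_cons; split=> [/orP[/eqP->|/wP[i ->]]|xq].
  - by rewrite expr0n; case: (q) q1.
  - rewrite exprAC; congr (_ ^+ _); rewrite -(prim_expr_mod prim_w) Euler_exp_totient //.
    by rewrite (prim_expr_mod prim_w) expr1.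
  have [//|x0] := eqVneq x 0; apply/sT; exists q.-1; first by rewrite -ltnS prednK // ltnW.
  by apply: (mulfI x0); rewrite -exprS prednK ?(ltnW q1) // xq mulr1.
have pq : ([pchar A]).-nat q.
  by rewrite pnatX (eq_pnat _ (pcharf_eq pA)) pnat_id.
split; rewrite ?inE.
- by apply/inE0; rewrite expr1n.
- move=> x y /inE0 xq /inE0 yq; apply/inE0; rewrite exprDn_pchar // xq.
  (* [(- y) ^+ q = - y] is read off from [y ^+ q + (- y) ^+ q = 0], whatever the parity of [q]. *)
  congr (_ + _); apply: (addrI y); rewrite -[X in X + _ = _]yq -exprDn_pchar //.
  by rewrite !subrr expr0n; case: (q) q1.
- by move=> x y /inE0 xq /inE0 yq; apply/inE0; rewrite exprMn xq yq.
Qed.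

Lemma card_finField_prime_power (F : finFieldType) p : p \in [pchar F] ->
  exists2 n, (1 <= n)%N & #|F| = (p ^ n)%N.
Proof.
move=> pF; have E := card_pprimeChar pF.
eexists; last exact: E.
rewrite lt0n; apply/eqP => n0; move: E; rewrite n0 expn0.
by move: (finNzRing_gt1 F) => /[swap] ->.
Qed.

Lemma units_char_positive (A : idomainType) p : p \in [pchar A] ->
  finitely_generated (units A) ->
  exists n g (F : finFieldType), [/\ (1 <= n)%N, #|F| = (p ^ n)%N
    & isomorphic (units A) ({unit F} * free_abelian g)%type].
Proof.
move=> pA fgA.
have [s s_uniq sT] := roots_of_unity_finite fgA.
have sR := roots_of_unity_field pA s_uniq sT.
have sT' x : x \in 0 :: s -> x != 0 -> is_root_of_unity x.
  by rewrite in_cons => /orP[->//|/sT].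
pose F : finFieldType := finite_subring sR sT'.
have pF : p \in [pchar F].
  have /andP[p_pr /eqP p0] := pA; apply/andP; split=> //; apply/eqP.
  by apply: val_inj; rewrite rmorph_nat rmorph0.
have [n n0 cardF] := card_finField_prime_power pF.
have rootF (x : F) : x != 0 -> is_root_of_unity (val x).
  by move=> x0; apply: (sT'); [apply: valP x | rewrite -(inj_eq val_inj) in x0].
have uF (x : {unit F}) : val (val x) \is a GRing.unit.
  apply: root_of_unity_unit; apply: rootF; rewrite -unitfE; exact: (valP x).
pose phi (x : {unit F}) : units A := MkUnits (uF x).
have [||x|g isoA] := @structure_iso _ (@units_abelian A) fgA _ phi.
- by move=> x y; apply: val_inj.
- by move=> x y /(congr1 val) E; apply/val_inj/val_inj; exact: E.
- rewrite torsion_units; split=> [[h <-]|xT].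
    by apply: rootF; rewrite -unitfE; exact: (valP h).
  have xs : val x \in 0 :: s by rewrite in_cons; apply/orP; right; apply/sT.
  pose y : F := SeqSub xs.
  have yU : y \is a GRing.unit.
    rewrite unitfE -(inj_eq val_inj); apply: contraTneq (root_of_unity_unit xT) => /= ->.
    by rewrite unitr0.
  by exists (FinRing.unit F yU); apply: val_inj.
by exists n, g, F.
Qed.

(** The field as a subring of itself, the starting point for adjoining Laurent variables to [F]. *)
Definition whole (K : fieldType) : {pred K} := predT.

Fact whole_subring_closed (K : fieldType) : subring_closed (@whole K).
Proof. by []. Qed.

HB.instance Definition _ (K : fieldType) :=
  GRing.isSubringClosed.Build K (@whole K) (@whole_subring_closed K).

Lemma finite_field_realization (F : finFieldType) g : exists A : idomainType,
  [pchar A] =i [pchar F] /\ isomorphic ({unit F} * free_abelian g)%type (units A).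
Proof.
apply: (@units_laurent_domain F (@whole F) _ (val : {unit F} -> F)); split => //.
- exact: val_inj.
- by move=> h; split => //; rewrite -unitfE; apply: (valP h).
- by move=> x x0 _ _; rewrite -unitfE in x0; exists (FinRing.unit F x0).
Qed.

Theorem theoremA (G : groupType) (abG : abelian_group G)
    (fgG : finitely_generated G) :
  ((exists A : idomainType, char_zero A /\ isomorphic G (units A)) <->
   (exists n g : nat,
      [/\ (1 <= n)%N,
          (totient (2 * n))%:R / 2 - 1 <= g%:R :> rat
        & isomorphic G (cyclic_group (2 * n) * free_abelian g)%type]))
  /\
  ((exists A : idomainType, char_positive A /\ isomorphic G (units A)) <->
   (exists (p n g : nat) (F : finFieldType),
      [/\ prime p, (1 <= n)%N, #|F| = (p ^ n)%N
        & isomorphic G ({unit F} * free_abelian g)%type])).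
Proof.
split; split.
- case=> A [A0 isoA].
  have [n [g [n0 gE isoU]]] := units_char_zero A0 (finitely_generated_iso isoA fgG).
  by exists n, g; split => //; apply: isomorphic_trans isoU.
- case=> n [g [n0 gE isoG]]; have [A [A0 isoA]] := char_zero_realization n0 gE.
  by exists A; split => //; apply: isomorphic_trans isoA.
- case=> A [[p pA] isoA].
  have [n [g [F [n0 cardF isoU]]]] := units_char_positive pA (finitely_generated_iso isoA fgG).
  exists p, n, g, F; split => //; first exact: (pcharf_prime pA).
  exact: isomorphic_trans isoU.
- case=> p [n [g [F [p_pr n0 cardF isoG]]]].
  have [A [charA isoA]] := finite_field_realization F g.
  exists A; split; last exact: isomorphic_trans isoA.
  by exists p; rewrite charA; apply: card_finPcharP cardF p_pr.
Qed.
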